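(* Let $\tilde p:\mathbb{D}\to\mathbb{C}$ be a holomorphic function with $\operatorname{Re}\tilde p\ge 0$, let $k\in\mathbb{R}$, and let $\{\psi_t\}_{t\ge 0}$ be the semigroup of holomorphic self-maps of $\mathbb{D}$ defined by $$\frac{d}{dt}\psi_t(z)=(\psi_t(z)-1)^2\,\tilde p(\psi_t(z))-ik\,\psi_t(z),\qquad \psi_0(z)=z,\quad z\in\mathbb{D},\ t\ge 0.$$ Then $\{\psi_t\}_{t\ge0}$ consists of automorphisms of $\mathbb{D}$ if and only if $\tilde p$ is of the form $$\tilde p(z)=A\,\frac{1+z}{1-z}+B\,i,\qquad A\ge 0,\ B\in\mathbb{R}.$$
   Context: $\mathbb{D}$ is the open unit disk in $\mathbb{C}$. For every holomorphic $\tilde p:\mathbb{D}\to\mathbb{C}$ with $\operatorname{Re}\tilde p\ge0$ and every $k\in\mathbb{R}$, the initial value problem in the claim has a unique solution for all $t\ge0$, and $\{\psi_t\}_{t\ge0}$ is a one-parameter continuous semigroup of holomorphic self-maps of $\mathbb{D}$. An automorphism of $\mathbb{D}$ is a biholomorphic self-map of $\mathbb{D}$. *)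

(* Defs.v *)
From Stdlib Require Import Reals.
From Coquelicot Require Import Coquelicot.
Open Scope C_scope.

Definition in_disk (z : C) : Prop := (Cmod z < 1)%R.

(* The disk is open, so complex differentiability at its points does not depend
   on the values of the total function [f] outside the disk. *)
Definition holomorphic_disk (f : C -> C) : Prop :=
  forall z : C, in_disk z -> ex_derive (K := C_AbsRing) (V := C_NormedModule) f z.

Definition maps_disk (f : C -> C) : Prop :=
  forall z : C, in_disk z -> in_disk (f z).

Definition disk_automorphism (f : C -> C) : Prop :=
  holomorphic_disk f /\ maps_disk f /\
  exists g : C -> C,
    holomorphic_disk g /\ maps_disk g /\
    (forall z : C, in_disk z -> g (f z) = z) /\
    (forall z : C, in_disk z -> f (g z) = z).

(* Derivative at [t] of a curve regarded as defined on [0, +oo) only: the usual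
   real-variable derivative for t > 0, the right derivative for t = 0. *)
Definition is_derive_nonneg (c : R -> C) (t : R) (l : C) : Prop :=
  filterdiff (K := R_AbsRing) (U := R_NormedModule) (V := C_R_NormedModule)
    c (within (fun s : R => (0 <= s)%R) (locally t))
    (fun h : R => scal h (l : C_R_NormedModule)).

(* [psi t z] is psi_t(z).  Since [p] is only meaningful on the disk, a solution
   is required to stay in the disk for all t >= 0. *)
Definition solves_ivp (p : C -> C) (k : R) (psi : R -> C -> C) : Prop :=
  forall z : C, in_disk z ->
    psi 0%R z = z /\
    forall t : R, (0 <= t)%R ->
      in_disk (psi t z) /\
      is_derive_nonneg (fun s : R => psi s z) t
        ((psi t z - 1) ^ 2 * p (psi t z) - Ci * k * psi t z).

(* Main.v *)
Require Import Defs.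
From Stdlib Require Import Reals Lra Psatz.
From Coquelicot Require Import Coquelicot.
Open Scope C_scope.

(* Let G(w) = (w - 1)^2 p(w) - i k w be the vector field.

   If every psi_t is an automorphism, the Schwarz lemma applied to psi_t and to its
   inverse gives |psi_t(z) - psi_t(0)| = |z| |1 - conj(psi_t(0)) psi_t(z)|.  Differentiating
   at t = 0 shows that (G(z) - a) / z + conj(a) z, with a = G(0), is purely imaginary,
   hence constant, so that G(z) = a - conj(a) z^2 + i m z.  Solving for p gives
   p(z) = A (1 + z)/(1 - z) + B i + i n z/(1 - z)^2 with A + B i = p(0), and Re p >= 0 along
   1/(1 - z) = 1 + i y, y real, forces n = 0.

   Conversely G is then quadratic, and the Riccati equation is linearised by
   exp(t X) in SU(1,1), so psi_t is a Moebius automorphism.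

   The Schwarz lemma is obtained from Goursat's theorem: with f(0) = 0, the mean over
   the circle of radius e^s of f(z)/z does not depend on s and tends to f'(0) as
   s -> -oo, whence |f'(0)| <= 1. *)

(** * Complex derivatives and the exponential *)

(** The codomain is [C] as a module over its own ring, the form in which the product rule is
    available; [ex_derive_cderiv] passes to and from [C_NormedModule]. *)
Definition cderiv (f : C -> C) (z l : C) : Prop :=
  is_derive (K := C_AbsRing) (V := AbsRing_NormedModule C_AbsRing) f z l.

Lemma cderiv_eps (f : C -> C) (z l : C) :
  cderiv f z l <->
  forall eps : R, (0 < eps)%R -> exists d : R, (0 < d)%R /\
    forall w : C, (Cmod (w - z) < d)%R ->
      (Cmod (f w - f z - (w - z) * l) <= eps * Cmod (w - z))%R.
Proof.
  split.
  - intros [_ H] eps Heps.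
    destruct (H z (fun P HP => HP) (mkposreal eps Heps)) as [d Hd].
    exists d; split; [apply cond_pos | exact Hd].
  - intros H; split.
    + apply is_linear_scal_l.
    + intros x Hx eps.
      rewrite <- (is_filter_lim_locally_unique _ _ Hx).
      destruct (H eps (cond_pos eps)) as [d [Hd0 Hd]].
      exists (mkposreal d Hd0); exact Hd.
Qed.

Lemma ex_derive_cderiv (f : C -> C) (z : C) :
  ex_derive (K := C_AbsRing) (V := C_NormedModule) f z <-> exists l : C, cderiv f z l.
Proof.
  split; intros [l [[H1 H2 H3] H]]; exists l; (split; [ split | exact H ]).
  - exact H1.
  - exact H2.
  - exact H3.
  - exact H1.
  - exact H2.
  - exact H3.
Qed.

Lemma cderiv_mult (f g : C -> C) (z l m : C) :
  cderiv f z l -> cderiv g z m -> cderiv (fun w => f w * g w) z (l * g z + f z * m).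
Proof. intros Hf Hg; apply (is_derive_mult f g z l m Hf Hg), Cmult_comm. Qed.

Lemma cderiv_plus (f g : C -> C) (z l m : C) :
  cderiv f z l -> cderiv g z m -> cderiv (fun w => f w + g w) z (l + m).
Proof. exact (is_derive_plus (K := C_AbsRing) (V := AbsRing_NormedModule C_AbsRing) f g z l m). Qed.

Lemma cderiv_minus (f g : C -> C) (z l m : C) :
  cderiv f z l -> cderiv g z m -> cderiv (fun w => f w - g w) z (l - m).
Proof. exact (is_derive_minus (K := C_AbsRing) (V := AbsRing_NormedModule C_AbsRing) f g z l m). Qed.

Lemma cderiv_const (c z : C) : cderiv (fun _ => c) z 0.
Proof. exact (is_derive_const (K := C_AbsRing) (V := AbsRing_NormedModule C_AbsRing) c z). Qed.

Lemma cderiv_id (z : C) : cderiv (fun w => w) z 1.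
Proof. exact (is_derive_id (K := C_AbsRing) z). Qed.

Lemma cderiv_comp (f g : C -> C) (z l m : C) :
  cderiv f (g z) l -> cderiv g z m -> cderiv (fun w => f (g w)) z (m * l).
Proof. exact (is_derive_comp (K := C_AbsRing) (V := AbsRing_NormedModule C_AbsRing) f g z l m). Qed.

Lemma cderiv_eq (f : C -> C) (z l m : C) : cderiv f z l -> l = m -> cderiv f z m.
Proof. now intros H <-. Qed.

Lemma cderiv_ext_near (f g : C -> C) (z l : C) (d : R) :
  (0 < d)%R -> (forall w, (Cmod (w - z) < d)%R -> f w = g w) ->
  cderiv f z l -> cderiv g z l.
Proof.
  intros Hd H; unfold cderiv; apply is_derive_ext_loc.
  exists (mkposreal d Hd); exact H.
Qed.

Lemma Cmod_minus_sym (a b : C) : Cmod (a - b) = Cmod (b - a).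
Proof. rewrite <- Cmod_opp; f_equal; ring. Qed.

Lemma Cmod_triangle_minus (a b : C) : (Cmod a <= Cmod b + Cmod (a - b))%R.
Proof.
  replace a with (b + (a - b)) at 1 by ring. apply Cmod_triangle.
Qed.

Lemma cderiv_inv (z : C) : z <> 0 -> cderiv Cinv z (- / (z * z)).
Proof.
  intros Hz; apply cderiv_eps; intros eps Heps.
  assert (Hr := proj1 (Cmod_gt_0 z) Hz); set (r := Cmod z) in *.
  assert (Hr3 : (0 < r * r * r)%R) by (repeat apply Rmult_lt_0_compat; lra).
  (* The error term is (w - z)^2 / (w z^2). The first bound keeps |w| above r/2, and the second then
     makes |w - z| / (|w| r^2) at most [eps]. *)
  exists (Rmin (r / 2) (eps * (r * r * r) / 2)); split.
  { apply Rmin_pos; nra. }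
  intros w Hw.
  assert (H1 := Rlt_le_trans _ _ _ Hw (Rmin_l _ _)).
  assert (H2 := Rlt_le_trans _ _ _ Hw (Rmin_r _ _)).
  assert (Hwr : (r / 2 < Cmod w)%R).
  { generalize (Cmod_triangle_minus z w); rewrite Cmod_minus_sym; fold r; lra. }
  assert (Hw0 : w <> 0) by (intros ->; rewrite Cmod_0 in Hwr; lra).
  replace (/ w - / z - (w - z) * - / (z * z))
    with ((w - z) * ((w - z) / (w * (z * z)))) by (field; tauto).
  rewrite Cmod_mult, Rmult_comm.
  apply Rmult_le_compat_r; [apply Cmod_ge_0|].
  rewrite Cmod_div by (repeat apply Cmult_neq_0; assumption).
  rewrite !Cmod_mult; fold r.
  apply Rle_div_l; [nra|].
  assert (r / 2 * (r * r) <= Cmod w * (r * r))%R by (apply Rmult_le_compat_r; nra).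
  nra.
Qed.

Lemma cderiv_div (f g : C -> C) (z l m : C) :
  g z <> 0 -> cderiv f z l -> cderiv g z m ->
  cderiv (fun w => f w / g w) z ((l * g z - f z * m) / (g z * g z)).
Proof.
  intros H0 Hf Hg.
  apply cderiv_eq with (l * / g z + f z * (m * - / (g z * g z))).
  - apply (cderiv_mult f (fun w => / g w)); [exact Hf|].
    apply (cderiv_comp Cinv g); [now apply cderiv_inv | exact Hg].
  - field; exact H0.
Qed.

(** Provides polar coordinates on the punctured disk: circles about 0 become vertical segments of
    length 2 pi, so that Goursat's theorem on rectangles applies to them. *)
Definition cexp (z : C) : C := (exp (Re z) * cos (Im z), exp (Re z) * sin (Im z))%R.

Lemma cexp_plus (z w : C) : cexp (z + w) = cexp z * cexp w.
Proof.
  destruct z as [x y], w as [x' y'].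
  unfold cexp; simpl; rewrite exp_plus, cos_plus, sin_plus.
  unfold Cmult; simpl; f_equal; ring.
Qed.

Lemma Cmod_cexp (z : C) : Cmod (cexp z) = exp (Re z).
Proof.
  unfold Cmod, cexp; simpl.
  transitivity (sqrt (exp (Re z) * exp (Re z))); [f_equal | apply sqrt_square; left; apply exp_pos].
  generalize (sin2_cos2 (Im z)); unfold Rsqr; nra.
Qed.

Lemma is_derive_eps (f : R -> R) (x l : R) :
  is_derive f x l <->
  forall eps : R, (0 < eps)%R -> exists d : R, (0 < d)%R /\
    forall y : R, (Rabs (y - x) < d)%R ->
      (Rabs (f y - f x - (y - x) * l) <= eps * Rabs (y - x))%R.
Proof.
  split.
  - intros [_ H] eps Heps.
    destruct (H x (fun P HP => HP) (mkposreal eps Heps)) as [d Hd].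
    exists d; split; [apply cond_pos | exact Hd].
  - intros H; split.
    + apply @is_linear_scal_l.
    + intros x' Hx eps.
      rewrite <- (is_filter_lim_locally_unique _ _ Hx).
      destruct (H eps (cond_pos eps)) as [d [Hd0 Hd]].
      exists (mkposreal d Hd0); exact Hd.
Qed.

Lemma Rabs_Im_le (z : C) : (Rabs (Im z) <= Cmod z)%R.
Proof. eapply Rle_trans; [apply Rmax_r | apply Rmax_Cmod]. Qed.

Lemma Cmod_le_Re_Im (z : C) : (Cmod z <= Rabs (Re z) + Rabs (Im z))%R.
Proof.
  replace z with (RtoC (Re z) + Ci * RtoC (Im z)) at 1.
  - eapply Rle_trans; [apply Cmod_triangle|].
    rewrite Cmod_mult, Cmod_Ci, !Cmod_R; lra.
  - destruct z as [x y]; unfold Cplus, Cmult; simpl; f_equal; ring.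
Qed.

Lemma cderiv_cexp_0 : cderiv cexp 0 1.
Proof.
  apply cderiv_eps; intros eps Heps.
  (* The real and imaginary parts of the error will each be at most 3 e r, hence the 6. The cap 1
     gives r < 1/2 below, hence exp x <= 2. *)
  set (e := Rmin (eps / 6) 1).
  assert (He : (0 < e)%R) by (apply Rmin_pos; lra).
  assert (He1 : (e <= 1)%R) by apply Rmin_r.
  assert (He2 : (e <= eps / 6)%R) by apply Rmin_l.
  assert (D1 : is_derive exp 0 1) by (apply is_derive_Reals, derivable_pt_lim_exp_0).
  assert (D2 : is_derive sin 0 1) by (apply is_derive_Reals, derivable_pt_lim_sin_0).
  assert (D3 : is_derive cos 0 0) by (apply is_derive_Reals, derivable_pt_lim_cos_0).
  destruct (proj1 (is_derive_eps _ _ _) D1 e He) as [d1 [Hd1 H1]].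
  destruct (proj1 (is_derive_eps _ _ _) D2 e He) as [d2 [Hd2 H2]].
  destruct (proj1 (is_derive_eps _ _ _) D3 e He) as [d3 [Hd3 H3]].
  exists (Rmin (Rmin d1 d2) (Rmin d3 (e / 2))); split.
  { repeat apply Rmin_pos; lra. }
  intros [x y] Hw.
  replace ((x, y) - 0) with (x, y) in * by (unfold Cminus, Cplus; simpl; f_equal; ring).
  assert (Hx := re_le_Cmod (x, y)); assert (Hy := Rabs_Im_le (x, y)); simpl in Hx, Hy.
  set (r := Cmod (x, y)) in *.
  assert (K1 := Rlt_le_trans _ _ _ Hw (Rmin_l _ _)).
  assert (K2 := Rlt_le_trans _ _ _ Hw (Rmin_r _ _)).
  assert (K3 := Rlt_le_trans _ _ _ K1 (Rmin_l _ _)).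
  assert (K4 := Rlt_le_trans _ _ _ K1 (Rmin_r _ _)).
  assert (K5 := Rlt_le_trans _ _ _ K2 (Rmin_l _ _)).
  assert (K6 := Rlt_le_trans _ _ _ K2 (Rmin_r _ _)).
  specialize (H1 x); specialize (H2 y); specialize (H3 y).
  rewrite !Rminus_0_r in H1, H2, H3.
  rewrite exp_0 in H1; rewrite sin_0 in H2; rewrite cos_0 in H3.
  specialize (H1 ltac:(lra)); specialize (H2 ltac:(lra)); specialize (H3 ltac:(lra)).
  rewrite Rmult_1_r in H1, H2; rewrite Rminus_0_r in H2; rewrite Rmult_0_r, Rminus_0_r in H3.
  assert (Hr : (0 <= r)%R) by apply Cmod_ge_0.
  assert (Pex : (e * Rabs x <= e * r)%R) by (apply Rmult_le_compat_l; lra).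
  assert (Pey : (e * Rabs y <= e * r)%R) by (apply Rmult_le_compat_l; lra).
  assert (Per : (e * r <= 1 * r)%R) by (apply Rmult_le_compat_r; lra).
  assert (E1 : (Rabs (exp x - 1) <= 2 * r)%R).
  { replace (exp x - 1)%R with ((exp x - 1 - x) + x)%R by ring.
    eapply Rle_trans; [apply Rabs_triang|]. lra. }
  assert (E2 : (Rabs (exp x) <= 2)%R).
  { replace (exp x) with ((exp x - 1) + 1)%R by ring.
    eapply Rle_trans; [apply Rabs_triang|]. rewrite Rabs_R1. lra. }
  eapply Rle_trans; [apply Cmod_le_Re_Im|].
  assert (F1 : (Re (cexp (x, y) - cexp 0 - (x, y) * 1) =
     (exp x - 1 - x) + exp x * (cos y - 1))%R).
  { unfold cexp; simpl; rewrite ?exp_0, ?cos_0, ?sin_0; ring. }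
  assert (F2 : (Im (cexp (x, y) - cexp 0 - (x, y) * 1) =
     exp x * (sin y - y) + (exp x - 1) * y)%R).
  { unfold cexp; simpl; rewrite ?exp_0, ?cos_0, ?sin_0; ring. }
  rewrite F1, F2.
  assert (G1 : (Rabs ((exp x - 1 - x) + exp x * (cos y - 1)) <= 3 * e * r)%R).
  { eapply Rle_trans; [apply Rabs_triang|]. rewrite Rabs_mult.
    assert (Rabs (exp x) * Rabs (cos y - 1) <= 2 * (e * r))%R.
    { apply Rmult_le_compat; try apply Rabs_pos; lra. }
    lra. }
  assert (G2 : (Rabs (exp x * (sin y - y) + (exp x - 1) * y) <= 3 * e * r)%R).
  { eapply Rle_trans; [apply Rabs_triang|]. rewrite !Rabs_mult.
    assert (Rabs (exp x) * Rabs (sin y - y) <= 2 * (e * r))%R.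
    { apply Rmult_le_compat; try apply Rabs_pos; lra. }
    assert (r * r <= e / 2 * r)%R by (apply Rmult_le_compat_r; lra).
    assert (Rabs (exp x - 1) * Rabs y <= 2 * r * r)%R.
    { apply Rmult_le_compat; try apply Rabs_pos; lra. }
    lra. }
  assert (e * r <= eps / 6 * r)%R by (apply Rmult_le_compat_r; lra).
  lra.
Qed.

(** The functional equation exp w = exp z exp (w - z) carries the derivative at 0 to [z]. *)
Lemma cderiv_cexp (z : C) : cderiv cexp z (cexp z).
Proof.
  apply (is_derive_ext (K := C_AbsRing) (V := AbsRing_NormedModule C_AbsRing)
           (fun w => cexp z * cexp (w - z))).
  { intros w; rewrite <- cexp_plus; f_equal; ring. }
  eapply cderiv_eq.
  - apply (cderiv_mult (fun _ => cexp z) (fun w => cexp (w - z)));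
      [apply cderiv_const|].
    apply (cderiv_comp cexp (fun w => w - z)).
    + replace (z - z) with (RtoC 0) by ring. apply cderiv_cexp_0.
    + apply (cderiv_minus (fun w => w) (fun _ => z)); [apply cderiv_id | apply cderiv_const].
  - ring.
Qed.

(** * Goursat's theorem on rectangles *)

Open Scope R_scope.

Lemma nested_intervals (a b : nat -> R) :
  (forall n, a n <= a (S n)) -> (forall n, b (S n) <= b n) -> (forall n, a n <= b n) ->
  exists x, forall n, a n <= x <= b n.
Proof.
  intros Ha Hb Hab.
  assert (Ha' : forall n k, a n <= a (k + n)%nat).
  { intros n k; induction k as [|k IH]; simpl; [lra | specialize (Ha (k + n)%nat); lra]. }
  assert (Hb' : forall n k, b (k + n)%nat <= b n).
  { intros n k; induction k as [|k IH]; simpl; [lra | specialize (Hb (k + n)%nat); lra]. }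
  assert (H : forall m n, a m <= b n).
  { intros m n.
    specialize (Ha' m n); specialize (Hb' n m); specialize (Hab (m + n)%nat).
    rewrite Nat.add_comm in Ha'; lra. }
  destruct (completeness (fun x => exists n, x = a n)) as [x [Hx1 Hx2]].
  - exists (b 0%nat); intros y [n ->]; apply H.
  - exists (a 0%nat), 0%nat; reflexivity.
  - exists x; intros n; split.
    + apply Hx1; now exists n.
    + apply Hx2; intros y [m ->]; apply H.
Qed.

(** Real differentiability of u + i v with the Cauchy-Riemann equations built into the Jacobian; A +
    i B is the complex derivative. *)
Definition cr_diff (u v : R -> R -> R) (x y : R) : Prop :=
  exists A B : R, forall eps : R, 0 < eps -> exists d : R, 0 < d /\
    forall x' y' : R, Rabs (x' - x) < d -> Rabs (y' - y) < d ->
      Rabs (u x' y' - u x y - (A * (x' - x) - B * (y' - y)))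
        <= eps * (Rabs (x' - x) + Rabs (y' - y)) /\
      Rabs (v x' y' - v x y - (B * (x' - x) + A * (y' - y)))
        <= eps * (Rabs (x' - x) + Rabs (y' - y)).

(* The contour integral of [u dy + v dx], the imaginary part of [(u + i v) dz]. *)
Definition contour (u v : R -> R -> R) (a b c d : R) : R :=
  RInt (u b) c d - RInt (u a) c d + RInt (fun x => v x c) a b - RInt (fun x => v x d) a b.

Lemma continuous_of_linear_bound (f : R -> R) (x l : R) :
  (exists d, 0 < d /\ forall y, Rabs (y - x) < d ->
     Rabs (f y - f x - l * (y - x)) <= Rabs (y - x)) ->
  continuous f x.
Proof.
  intros [d [Hd H]].
  apply (proj1 (continuity_pt_filterlim f x)).
  intros e He.
  exists (Rmin d (e / (Rabs l + 2))).
  assert (Hl := Rabs_pos l).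
  split.
  - apply Rmin_pos; [lra | apply Rdiv_lt_0_compat; lra].
  - intros y [_ Hy]; simpl in *; unfold R_dist in *.
    assert (H1 := Rlt_le_trans _ _ _ Hy (Rmin_l _ _)).
    assert (H2 := Rlt_le_trans _ _ _ Hy (Rmin_r _ _)).
    apply Rlt_div_r in H2; [|lra].
    specialize (H y H1).
    replace (f y - f x) with ((f y - f x - l * (y - x)) + l * (y - x)) by ring.
    eapply Rle_lt_trans; [apply Rabs_triang|]. rewrite Rabs_mult.
    assert (Hy0 := Rabs_pos (y - x)).
    nra.
Qed.

Lemma cr_diff_continuous (u v : R -> R -> R) (x y : R) :
  cr_diff u v x y -> continuous (u x) y /\ continuous (fun t => v t y) x.
Proof.
  intros [A [B H]]; destruct (H 1 Rlt_0_1) as [d [Hd Hd']]; split.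
  - apply continuous_of_linear_bound with (- B); exists d; split; [exact Hd|].
    intros z Hz; destruct (Hd' x z) as [H1 _].
    + rewrite Rminus_eq_0, Rabs_R0; exact Hd.
    + exact Hz.
    + rewrite Rminus_eq_0, Rabs_R0, Rplus_0_l, Rmult_1_l in H1.
      replace (- B * (z - y)) with (A * 0 - B * (z - y)) by ring; exact H1.
  - apply continuous_of_linear_bound with B; exists d; split; [exact Hd|].
    intros z Hz; destruct (Hd' z y) as [_ H1].
    + exact Hz.
    + rewrite Rminus_eq_0, Rabs_R0; exact Hd.
    + rewrite Rminus_eq_0, Rabs_R0, Rplus_0_r, Rmult_1_l in H1.
      replace (B * (z - x)) with (B * (z - x) + A * 0) by ring; exact H1.
Qed.

Section Goursat.
Variables (u v : R -> R -> R) (a0 b0 c0 d0 : R).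
Hypothesis Huv : forall x y, a0 <= x <= b0 -> c0 <= y <= d0 -> cr_diff u v x y.

Lemma ex_RInt_vertical (x c d : R) :
  a0 <= x <= b0 -> c0 <= c -> c <= d -> d <= d0 -> ex_RInt (u x) c d.
Proof.
  intros Hx Hc Hcd Hd; apply (ex_RInt_continuous (V := R_CompleteNormedModule)).
  intros z; rewrite Rmin_left, Rmax_right by lra; intros Hz.
  apply cr_diff_continuous with (v := v), Huv; lra.
Qed.

Lemma ex_RInt_horizontal (y a b : R) :
  c0 <= y <= d0 -> a0 <= a -> a <= b -> b <= b0 -> ex_RInt (fun x => v x y) a b.
Proof.
  intros Hx Hc Hcd Hd; apply (ex_RInt_continuous (V := R_CompleteNormedModule)).
  intros z; rewrite Rmin_left, Rmax_right by lra; intros Hz.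
  apply (cr_diff_continuous u v), Huv; lra.
Qed.

(** Each inner edge is traversed once in each direction, so its contributions cancel. *)
Lemma contour_split (a m b c n d : R) :
  a0 <= a -> a <= m -> m <= b -> b <= b0 -> c0 <= c -> c <= n -> n <= d -> d <= d0 ->
  contour u v a b c d =
    contour u v a m c n + contour u v m b c n + contour u v a m n d + contour u v m b n d.
Proof.
  intros Ha Ham Hmb Hb Hc Hcn Hnd Hd; unfold contour.
  assert (Hu : forall x, a0 <= x <= b0 -> RInt (u x) c d = RInt (u x) c n + RInt (u x) n d).
  { intros x Hx; symmetry; apply (RInt_Chasles (V := R_CompleteNormedModule));
      apply ex_RInt_vertical; lra. }
  assert (Hv : forall y, c0 <= y <= d0 ->
     RInt (fun x => v x y) a b = RInt (fun x => v x y) a m + RInt (fun x => v x y) m b).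
  { intros y Hy; symmetry; apply (RInt_Chasles (V := R_CompleteNormedModule));
      apply ex_RInt_horizontal; lra. }
  rewrite (Hu a), (Hu b), (Hv c), (Hv d) by lra. ring.
Qed.

(** Meant for opposite sides of a small rectangle, with [m] the difference predicted by the linear
    part; with [g] zero it also estimates the mean over a small circle. *)
Lemma RInt_diff_bound (f g : R -> R) (a b m M : R) :
  a <= b -> ex_RInt f a b -> ex_RInt g a b ->
  (forall t, a <= t <= b -> Rabs (f t - g t - m) <= M) ->
  Rabs (RInt f a b - RInt g a b - m * (b - a)) <= M * (b - a).
Proof.
  intros Hab Hf Hg H.
  assert (I : is_RInt (fun t => f t - g t - m) a b (RInt f a b - RInt g a b - m * (b - a))).
  { apply (is_RInt_minus (V := R_NormedModule) (fun t => f t - g t) (fun _ => m)).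
    - apply (is_RInt_minus (V := R_NormedModule)); apply (RInt_correct (V := R_CompleteNormedModule)); assumption.
    - rewrite Rmult_comm; apply (is_RInt_const (V := R_NormedModule)). }
  rewrite <- (is_RInt_unique _ _ _ _ I), (Rmult_comm M).
  apply abs_RInt_le_const; [exact Hab | eexists; exact I | exact H].
Qed.

(** By the Cauchy-Riemann equations the linear part contributes A (b - a)(d - c) through the
    vertical sides and its opposite through the horizontal ones. Only the error of the linear
    approximation remains. *)
Lemma contour_small (x y : R) :
  a0 <= x <= b0 -> c0 <= y <= d0 ->
  forall eps, 0 < eps -> exists e, 0 < e /\
    forall a b c d, a0 <= a -> b <= b0 -> c0 <= c -> d <= d0 ->
      a <= x <= b -> c <= y <= d -> b - a < e -> d - c < e ->
      Rabs (contour u v a b c d) <= eps * ((b - a) + (d - c)) ^ 2.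
Proof.
  intros Hx Hy eps Heps.
  destruct (Huv x y Hx Hy) as [A [B H]].
  (* Opposite sides are compared pointwise, which adds two errors of [eps / 2]. *)
  destruct (H (eps / 2) ltac:(lra)) as [e [He H']]; clear H.
  exists e; split; [exact He|].
  intros a b c d Ha Hb Hc Hd Hax Hcy Hab Hcd.
  set (L := (b - a) + (d - c)).
  assert (K : forall x' y', a <= x' <= b -> c <= y' <= d ->
    Rabs (u x' y' - u x y - (A * (x' - x) - B * (y' - y))) <= eps / 2 * L /\
    Rabs (v x' y' - v x y - (B * (x' - x) + A * (y' - y))) <= eps / 2 * L).
  { intros x' y' Hx' Hy'.
    assert (E1 : Rabs (x' - x) <= b - a) by (apply Rabs_le; lra).
    assert (E2 : Rabs (y' - y) <= d - c) by (apply Rabs_le; lra).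
    destruct (H' x' y') as [K1 K2]; [lra | lra |].
    assert (eps / 2 * (Rabs (x' - x) + Rabs (y' - y)) <= eps / 2 * L).
    { apply Rmult_le_compat_l; unfold L; lra. }
    split; lra. }
  assert (P : Rabs (RInt (u b) c d - RInt (u a) c d - A * (b - a) * (d - c)) <= eps * L * (d - c)).
  { apply RInt_diff_bound; [lra | apply ex_RInt_vertical; lra | apply ex_RInt_vertical; lra |].
    intros t Ht.
    destruct (K b t) as [K1 _]; [lra | lra |].
    destruct (K a t) as [K2 _]; [lra | lra |].
    apply Rabs_le_between in K1; apply Rabs_le_between in K2; apply Rabs_le; lra. }
  assert (Q : Rabs (RInt (fun t => v t c) a b - RInt (fun t => v t d) a b
                    - - (A * (d - c)) * (b - a)) <= eps * L * (b - a)).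
  { apply RInt_diff_bound; [lra | apply ex_RInt_horizontal; lra | apply ex_RInt_horizontal; lra |].
    intros t Ht.
    destruct (K t c) as [_ K1]; [lra | lra |].
    destruct (K t d) as [_ K2]; [lra | lra |].
    apply Rabs_le_between in K1; apply Rabs_le_between in K2; apply Rabs_le; lra. }
  replace (eps * L ^ 2) with (eps * L * (d - c) + eps * L * (b - a)) by (unfold L; ring).
  unfold contour.
  apply Rabs_le_between in P; apply Rabs_le_between in Q; apply Rabs_le; lra.
Qed.

Definition rect := ((R * R) * (R * R))%type.
Definition contour_rect (r : rect) : R :=
  contour u v (fst (fst r)) (snd (fst r)) (fst (snd r)) (snd (snd r)).

(** Selects a quarter whose contour is at least a fourth of the whole in absolute value. The last
    quarter is the default: when the other three fail the test, the triangle inequality forces it to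
    pass. A rectangle [a, b] x [c, d] is encoded as [((a, b), (c, d))]. *)
Definition quarter (r : rect) : rect :=
  let '((a, b), (c, d)) := r in
  let m := (a + b) / 2 in
  let n := (c + d) / 2 in
  let big q := Rle_dec (Rabs (contour_rect r) / 4) (Rabs (contour_rect q)) in
  if big ((a, m), (c, n)) then ((a, m), (c, n)) else
  if big ((m, b), (c, n)) then ((m, b), (c, n)) else
  if big ((a, m), (n, d)) then ((a, m), (n, d)) else ((m, b), (n, d)).

Definition inside (r : rect) : Prop :=
  a0 <= fst (fst r) /\ fst (fst r) <= snd (fst r) /\ snd (fst r) <= b0 /\
  c0 <= fst (snd r) /\ fst (snd r) <= snd (snd r) /\ snd (snd r) <= d0.

Lemma quarter_spec (r : rect) : inside r ->
  inside (quarter r) /\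
  Rabs (contour_rect r) / 4 <= Rabs (contour_rect (quarter r)) /\
  fst (fst r) <= fst (fst (quarter r)) /\ snd (fst (quarter r)) <= snd (fst r) /\
  fst (snd r) <= fst (snd (quarter r)) /\ snd (snd (quarter r)) <= snd (snd r) /\
  snd (fst (quarter r)) - fst (fst (quarter r)) = (snd (fst r) - fst (fst r)) / 2 /\
  snd (snd (quarter r)) - fst (snd (quarter r)) = (snd (snd r) - fst (snd r)) / 2.
Proof.
  destruct r as [[a b] [c d]]; unfold inside; simpl; intros Hr.
  assert (S := contour_split a ((a + b) / 2) b c ((c + d) / 2) d
    ltac:(lra) ltac:(lra) ltac:(lra) ltac:(lra) ltac:(lra) ltac:(lra) ltac:(lra) ltac:(lra)).
  unfold contour_rect; simpl.
  do 3 (match goal with |- context [Rle_dec ?x ?y] => destruct (Rle_dec x y) as [?|?] end;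
    [simpl; repeat split; lra |]).
  simpl; repeat split; try lra.
  match type of S with _ = ?p + ?q + ?r + ?s =>
    assert (T1 := Rabs_triang (p + q + r) s); assert (T2 := Rabs_triang (p + q) r);
    assert (T3 := Rabs_triang p q) end.
  rewrite <- S in T1; lra.
Qed.

(** Repeated quartering shrinks to a point. The contour loses at most a factor 4 per step, while
    near that point it is at most [eps] times the squared size, which loses exactly a factor 4. So
    the whole contour is at most [eps * L ^ 2] for every [eps]. *)
Theorem goursat : a0 <= b0 -> c0 <= d0 -> contour u v a0 b0 c0 d0 = 0.
Proof.
  intros Hab Hcd.
  set (r n := Nat.iter n quarter ((a0, b0), (c0, d0))).
  assert (Hin : forall n, inside (r n)).
  { induction n as [|n IH]; [unfold inside; simpl; lra | apply quarter_spec, IH]. }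
  assert (Hq := fun n => quarter_spec (r n) (Hin n)).
  change (forall n, inside (r (S n)) /\
  Rabs (contour_rect (r n)) / 4 <= Rabs (contour_rect (r (S n))) /\
  fst (fst (r n)) <= fst (fst (r (S n))) /\ snd (fst (r (S n))) <= snd (fst (r n)) /\
  fst (snd (r n)) <= fst (snd (r (S n))) /\ snd (snd (r (S n))) <= snd (snd (r n)) /\
  snd (fst (r (S n))) - fst (fst (r (S n))) = (snd (fst (r n)) - fst (fst (r n))) / 2 /\
  snd (snd (r (S n))) - fst (snd (r (S n))) = (snd (snd (r n)) - fst (snd (r n))) / 2) in Hq.
  destruct (nested_intervals (fun n => fst (fst (r n))) (fun n => snd (fst (r n)))) as [x Hx];
    [intros n; apply Hq | intros n; apply Hq | intros n; apply Hin |].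
  destruct (nested_intervals (fun n => fst (snd (r n))) (fun n => snd (snd (r n)))) as [y Hy];
    [intros n; apply Hq | intros n; apply Hq | intros n; apply Hin |].
  assert (Hw : forall n, snd (fst (r n)) - fst (fst (r n)) = (b0 - a0) * (/ 2) ^ n /\
                         snd (snd (r n)) - fst (snd (r n)) = (d0 - c0) * (/ 2) ^ n).
  { induction n as [|n IH]; [simpl; lra |].
    destruct (Hq n) as (_ & _ & _ & _ & _ & _ & H1 & H2); rewrite H1, H2.
    rewrite (proj1 IH), (proj2 IH); simpl; lra. }
  assert (HJ : forall n, Rabs (contour u v a0 b0 c0 d0) * (/ 4) ^ n <= Rabs (contour_rect (r n))).
  { induction n as [|n IH]; [simpl; unfold contour_rect; simpl; lra |].
    destruct (Hq n) as (_ & H1 & _); rewrite <- tech_pow_Rmult; lra. }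
  set (L := (b0 - a0) + (d0 - c0)).
  assert (Hall : forall eps, 0 < eps -> Rabs (contour u v a0 b0 c0 d0) <= eps * L ^ 2).
  { intros eps Heps.
    destruct (contour_small x y) with (eps := eps) as [e [He H]];
      [apply (Hx 0%nat) | apply (Hy 0%nat) | exact Heps |].
    (* After [N] halvings both sides are shorter than [e]; the [+ 1] covers a degenerate rectangle
       with [L] zero. *)
    destruct (pow_lt_1_zero (/ 2)) with (y := e / (L + 1)) as [N HN].
    { rewrite Rabs_pos_eq; lra. }
    { apply Rdiv_lt_0_compat; unfold L; lra. }
    specialize (HN N (Nat.le_refl N)).
    assert (Hp : 0 < (/ 2) ^ N) by (apply pow_lt; lra).
    rewrite Rabs_pos_eq in HN by lra.
    apply Rlt_div_r in HN; [|unfold L; lra].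
    destruct (Hin N) as (I1 & I2 & I3 & I4 & I5 & I6).
    destruct (Hw N) as [W1 W2].
    assert (HB : Rabs (contour_rect (r N)) <= eps * (L ^ 2 * (/ 4) ^ N)).
    { eapply Rle_trans; [apply H; auto|].
      - rewrite W1; unfold L in HN; nra.
      - rewrite W2; unfold L in HN; nra.
      - rewrite W1, W2; right.
        replace (/ 4) with (/ 2 * / 2) by lra; rewrite Rpow_mult_distr; unfold L; ring. }
    apply Rmult_le_reg_r with ((/ 4) ^ N); [apply pow_lt; lra|].
    specialize (HJ N); lra. }
  apply Rabs_eq_0, Rle_antisym; [|apply Rabs_pos].
  apply Rnot_lt_le; intros Hpos.
  assert (HL : 0 <= L ^ 2) by apply pow2_ge_0.
  (* With this [eps] the bound is at most half of the contour, which is absurd if the contour is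
     nonzero. *)
  assert (HH := Hall (Rabs (contour u v a0 b0 c0 d0) / (2 * (L ^ 2 + 1)))
    ltac:(apply Rdiv_lt_0_compat; lra)).
  apply (Rmult_le_compat_r (2 * (L ^ 2 + 1))) in HH; [|lra].
  replace (Rabs (contour u v a0 b0 c0 d0) / (2 * (L ^ 2 + 1)) * L ^ 2 * (2 * (L ^ 2 + 1)))
    with (Rabs (contour u v a0 b0 c0 d0) * L ^ 2) in HH by (field; lra).
  nra.
Qed.
End Goursat.

Open Scope C_scope.

(** * The Schwarz lemma *)

Lemma cderiv_cr_diff (f : C -> C) (x y : R) (l : C) : cderiv f (x, y) l ->
  cr_diff (fun s t => Re (f (s, t))) (fun s t => Im (f (s, t))) x y.
Proof.
  intros H; exists (Re l), (Im l); intros eps Heps.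
  destruct (proj1 (cderiv_eps _ _ _) H eps Heps) as [d [Hd Hd']].
  exists (d / 2)%R; split; [lra|].
  intros x' y' Hx Hy.
  assert (E : (Cmod ((x', y') - (x, y)) <= Rabs (x' - x) + Rabs (y' - y))%R)
    by apply (Cmod_le_Re_Im ((x', y') - (x, y))).
  specialize (Hd' (x', y') ltac:(lra)).
  apply (Rmult_le_compat_l eps) in E; [|lra].
  split; (eapply Rle_trans; [|apply (Rle_trans _ _ _ Hd' E)]).
  - eapply Rle_trans; [|apply re_le_Cmod]; right; f_equal; simpl.
    destruct l; simpl; unfold Re, Im; simpl; ring.
  - eapply Rle_trans; [|apply Rabs_Im_le]; right; f_equal; simpl.
    destruct l; simpl; unfold Re, Im; simpl; ring.
Qed.

(** Suppose k = |l| > 1. The mean of Re (conj l f(w)/w) over |w| = e^s is independent of s. It is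
    within k e of k^2 on a small circle and at most k (1 + e) on the circle of radius 1/(1 + e),
    whence k <= 1 + 2 e. *)
Lemma schwarz_derivative_0 (f : C -> C) (l : C) :
  (forall z, in_disk z -> exists m, cderiv f z m) -> maps_disk f -> f 0 = 0 ->
  cderiv f 0 l -> (Cmod l <= 1)%R.
Proof.
  intros Hf Hmap Hf0 Hl.
  apply Rnot_lt_le; intros Hgt.
  set (k := Cmod l) in *.
  set (H := fun z => Cconj l * (f (cexp z) / cexp z)).
  set (u := fun s t => Re (H (s, t))); set (v := fun s t => Im (H (s, t))).
  assert (Hexp0 : forall z, cexp z <> 0).
  { intros z; apply Cmod_gt_0; rewrite Cmod_cexp; apply exp_pos. }
  assert (Hdisk : forall s t : R, (s < 0)%R -> in_disk (cexp (s, t))).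
  { intros s t Hs; unfold in_disk; rewrite Cmod_cexp; simpl.
    rewrite <- exp_0; apply exp_increasing, Hs. }
  assert (Hcr : forall s t : R, (s < 0)%R -> cr_diff u v s t).
  { intros s t Hs; destruct (Hf _ (Hdisk s t Hs)) as [m Hm].
    eapply (cderiv_cr_diff H).
    apply (cderiv_mult (fun _ => Cconj l)); [apply cderiv_const|].
    apply (cderiv_div (fun z => f (cexp z)) cexp); [apply Hexp0 | | apply cderiv_cexp].
    apply (cderiv_comp f cexp); [exact Hm | apply cderiv_cexp]. }
  assert (HPI := PI_RGT_0).
  assert (Hint : forall s : R, (s < 0)%R -> ex_RInt (u s) 0 (2 * PI)).
  { intros s Hs. apply (ex_RInt_vertical u v s s 0 (2 * PI)); try lra.
    intros x y Hx Hy; apply Hcr; lra. }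
  assert (Hconst : forall s1 s2 : R, (s1 <= s2)%R -> (s2 < 0)%R ->
            RInt (u s2) 0 (2 * PI) = RInt (u s1) 0 (2 * PI)).
  { intros s1 s2 H12 H2.
    assert (G := goursat u v s1 s2 0 (2 * PI)
                   ltac:(intros x y Hx Hy; apply Hcr; lra) H12 ltac:(lra)).
    unfold contour in G.
    (* The exponential has period 2 pi i, so the horizontal sides cancel and the vertical integrals
       agree. *)
    assert (E : RInt (fun x : R => v x 0%R) s1 s2 = RInt (fun x : R => v x (2 * PI)%R) s1 s2).
    { apply RInt_ext; intros x _; unfold v, H.
      replace (cexp (x, (2 * PI)%R)) with (cexp (x, 0%R)); [reflexivity|].
      unfold cexp; simpl; rewrite cos_2PI, sin_2PI, cos_0, sin_0; reflexivity. }
    rewrite E in G; lra. }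
  (* This makes 1 + 2 e = (k + 1)/2, which is smaller than k. *)
  set (e := ((k - 1) / 4)%R).
  assert (He : (0 < e)%R) by (unfold e; lra).
  assert (Hln : (0 < ln (1 + e))%R) by (rewrite <- ln_1; apply ln_increasing; lra).
  assert (Hup : (Rabs (RInt (u (- ln (1 + e))%R) 0 (2 * PI)) <= (2 * PI - 0) * (k * (1 + e)))%R).
  { apply abs_RInt_le_const; [lra | apply Hint; lra |].
    intros t _; eapply Rle_trans; [apply re_le_Cmod|].
    unfold H; rewrite Cmod_mult, Cmod_conj, Cmod_div by apply Hexp0; fold k.
    rewrite Cmod_cexp; simpl; unfold Rdiv; rewrite <- exp_Ropp, Ropp_involutive, exp_ln by lra.
    apply Rmult_le_compat_l; [lra|].
    assert (D := Hmap _ (Hdisk (- ln (1 + e))%R t ltac:(lra))); unfold in_disk in D.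
    nra. }
  destruct (proj1 (cderiv_eps _ _ _) Hl e He) as [d [Hd Hd']].
  (* The radius e^s1 is below [d], where f(w)/w is within [e] of [l], and does not exceed the radius
     1/(1 + e) of the outer circle. *)
  set (s1 := Rmin (- ln (1 + e)) (ln d - 1)).
  assert (Hs1 : (s1 <= - ln (1 + e))%R) by apply Rmin_l.
  assert (Hs1' : (exp s1 < d)%R).
  { rewrite <- (exp_ln d) by exact Hd; apply exp_increasing.
    apply Rle_lt_trans with (ln d - 1)%R; [apply Rmin_r | lra]. }
  assert (Hlow : (Rabs (RInt (u s1) 0 (2 * PI) - RInt (fun _ => 0%R) 0 (2 * PI)
                     - k ^ 2 * (2 * PI - 0)) <= k * e * (2 * PI - 0))%R).
  { apply RInt_diff_bound; [lra | apply Hint; lra | apply (ex_RInt_const (V := R_NormedModule)) |].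
    intros t _.
    set (w := cexp (s1, t)).
    assert (Hw : Cmod w = exp s1) by apply Cmod_cexp.
    assert (Hw0 : w <> 0) by apply Hexp0.
    specialize (Hd' w).
    replace (w - 0) with w in Hd' by ring; rewrite Hw, Hf0 in Hd'; specialize (Hd' Hs1').
    replace (u s1 t - 0 - k ^ 2)%R with (Re (Cconj l * (f w / w - l))).
    2:{ unfold u, H; fold w; unfold k.
        replace (Cmod l ^ 2)%R with (Re (Cconj l * l)).
        - unfold Re; simpl; ring.
        - rewrite Cmult_comm, <- Cmod2_conj; reflexivity. }
    eapply Rle_trans; [apply re_le_Cmod|].
    rewrite Cmod_mult, Cmod_conj; fold k; apply Rmult_le_compat_l; [lra|].
    replace (f w / w - l) with ((f w - 0 - w * l) / w) by (field; exact Hw0).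
    rewrite Cmod_div, Hw by exact Hw0.
    apply Rle_div_l; [apply exp_pos | exact Hd']. }
  rewrite RInt_const in Hlow; change (scal (2 * PI - 0)%R 0%R) with ((2 * PI - 0) * 0)%R in Hlow.
  rewrite (Hconst s1 (- ln (1 + e))%R Hs1) in Hup by lra.
  apply Rabs_le_between in Hup; apply Rabs_le_between in Hlow.
  assert (Hfin : (2 * PI * (k ^ 2) <= 2 * PI * (k * (1 + 2 * e)))%R) by lra.
  apply Rmult_le_reg_l in Hfin; [|lra].
  unfold e in Hfin; nra.
Qed.

(** * Moebius automorphisms of the disk taking [c] to 0, and the Schwarz-Pick inequality *)

Definition mobius (c z : C) : C := (z - c) / (1 - Cconj c * z).

Lemma Cmod_sqr_lt_1 (z : C) : in_disk z -> (Cmod z ^ 2 < 1)%R.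
Proof. unfold in_disk; assert (H := Cmod_ge_0 z); simpl; nra. Qed.

Lemma mobius_den (c z : C) : in_disk c -> in_disk z -> 1 - Cconj c * z <> 0.
Proof.
  intros Hc Hz H.
  assert (E : RtoC 1 = Cconj c * z).
  { replace (Cconj c * z) with (1 - (1 - Cconj c * z)) by ring; rewrite H; ring. }
  apply (f_equal Cmod) in E; rewrite Cmod_1, Cmod_mult, Cmod_conj in E.
  unfold in_disk in *; assert (H1 := Cmod_ge_0 c); assert (H2 := Cmod_ge_0 z); nra.
Qed.

(** For [c] and [z] in the disk the right side is positive, so the numerator of [mobius c z] is
    smaller in modulus than the denominator. *)
Lemma mobius_identity (c z : C) :
  (Cmod (1 - Cconj c * z) ^ 2 - Cmod (z - c) ^ 2 = (1 - Cmod c ^ 2) * (1 - Cmod z ^ 2))%R.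
Proof. rewrite !Cmod2_alt; destruct c, z; simpl; ring. Qed.

Lemma mobius_disk (c z : C) : in_disk c -> in_disk z -> in_disk (mobius c z).
Proof.
  intros Hc Hz; assert (D := mobius_den c z Hc Hz); unfold in_disk, mobius.
  rewrite Cmod_div by exact D.
  assert (P := proj1 (Cmod_gt_0 _) D).
  apply Rlt_div_l; [exact P|]; rewrite Rmult_1_l.
  assert (I := mobius_identity c z).
  assert (Hc2 := Cmod_sqr_lt_1 c Hc); assert (Hz2 := Cmod_sqr_lt_1 z Hz).
  assert (0 < (1 - Cmod c ^ 2) * (1 - Cmod z ^ 2))%R by (apply Rmult_lt_0_compat; lra).
  apply Rsqr_incrst_0; [unfold Rsqr; simpl in *; lra | apply Cmod_ge_0 | lra].
Qed.

Lemma in_disk_opp (c : C) : in_disk c -> in_disk (- c).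
Proof. unfold in_disk; now rewrite Cmod_opp. Qed.

Lemma in_disk_0 : in_disk 0.
Proof. unfold in_disk; rewrite Cmod_0; lra. Qed.

Lemma one_minus_Cmod2_neq_0 (c : C) : in_disk c -> 1 - Cconj c * c <> 0.
Proof. intros Hc; apply mobius_den; assumption. Qed.

Lemma mobius_opp_inv (c z : C) : in_disk c -> in_disk z -> mobius (- c) (mobius c z) = z.
Proof.
  intros Hc Hz; assert (D := mobius_den c z Hc Hz).
  assert (Dc := one_minus_Cmod2_neq_0 c Hc).
  assert (D' := mobius_den _ _ (in_disk_opp c Hc) (mobius_disk c z Hc Hz)).
  unfold mobius in *; rewrite Copp_conj in *.
  assert (E : 1 - - Cconj c * ((z - c) / (1 - Cconj c * z))
              = (1 - Cconj c * c) / (1 - Cconj c * z)) by (field; exact D).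
  rewrite E; field; auto.
Qed.

Lemma cderiv_mobius (c z : C) : in_disk c -> in_disk z ->
  cderiv (mobius c) z ((1 - Cconj c * c) / ((1 - Cconj c * z) * (1 - Cconj c * z))).
Proof.
  intros Hc Hz; assert (D := mobius_den c z Hc Hz).
  eapply cderiv_eq.
  - apply (cderiv_div (fun z => z - c) (fun z => 1 - Cconj c * z)); [exact D | |].
    + apply (cderiv_minus (fun z => z) (fun _ => c)); [apply cderiv_id | apply cderiv_const].
    + apply (cderiv_minus (fun _ => 1) (fun z => Cconj c * z)); [apply cderiv_const|].
      apply (cderiv_mult (fun _ => Cconj c) (fun z => z)); [apply cderiv_const | apply cderiv_id].
  - field; exact D.
Qed.

(** Composing [f] with Moebius maps that move 0 to [z] and [f z] to 0 gives a self-map fixing 0,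
    with derivative (1 - |z|^2) l / (1 - |f(z)|^2) there. *)
Lemma schwarz_pick_derivative (f : C -> C) (z l : C) :
  (forall w, in_disk w -> exists m, cderiv f w m) -> maps_disk f ->
  in_disk z -> cderiv f z l ->
  (Cmod l * (1 - Cmod z ^ 2) <= 1 - Cmod (f z) ^ 2)%R.
Proof.
  intros Hf Hmap Hz Hl.
  assert (Hfz := Hmap z Hz).
  assert (Hz' := in_disk_opp z Hz).
  assert (Ez : mobius (- z) 0 = z).
  { unfold mobius; rewrite Copp_conj; field. }
  assert (Df := one_minus_Cmod2_neq_0 (f z) Hfz).
  assert (HF : forall w m, in_disk w -> cderiv f (mobius (- z) w) m ->
     cderiv (fun w => mobius (f z) (f (mobius (- z) w))) w
      ((1 - Cconj (- z) * - z) / ((1 - Cconj (- z) * w) * (1 - Cconj (- z) * w)) * m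
       * ((1 - Cconj (f z) * f z) / ((1 - Cconj (f z) * f (mobius (- z) w))
                                     * (1 - Cconj (f z) * f (mobius (- z) w)))))).
  { intros w m Hw Hm.
    apply (cderiv_comp (mobius (f z)) (fun w => f (mobius (- z) w))).
    - apply cderiv_mobius; [exact Hfz | apply Hmap, mobius_disk; assumption].
    - apply (cderiv_comp f (mobius (- z))); [exact Hm | now apply cderiv_mobius]. }
  assert (S : (Cmod ((1 - Cconj z * z) * l / (1 - Cconj (f z) * f z)) <= 1)%R).
  { apply (schwarz_derivative_0 (fun w => mobius (f z) (f (mobius (- z) w)))).
    - intros w Hw; destruct (Hf (mobius (- z) w)) as [m Hm]; [now apply mobius_disk|].
      eexists; apply HF; eassumption.
    - intros w Hw; apply mobius_disk; [exact Hfz | now apply Hmap, mobius_disk].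
    - rewrite Ez; unfold mobius; field; exact Df.
    - eapply cderiv_eq; [apply HF; [apply in_disk_0 | rewrite Ez; exact Hl]|].
      rewrite Ez, Copp_conj; field; exact Df. }
  assert (R1 : forall w, in_disk w -> Cmod (1 - Cconj w * w) = (1 - Cmod w ^ 2)%R).
  { intros w Hw. rewrite Cmult_comm, <- Cmod2_conj, <- RtoC_minus, Cmod_R, Rabs_pos_eq;
      [reflexivity | apply Cmod_sqr_lt_1 in Hw; lra]. }
  rewrite Cmod_div, Cmod_mult, !R1 in S by assumption.
  assert (Q := Cmod_sqr_lt_1 _ Hfz).
  apply Rle_div_l in S; lra.
Qed.

Lemma nonincreasing_of_derivative (f : R -> R) (a b : R) :
  (a <= b)%R -> (forall t, (a <= t <= b)%R -> exists l, is_derive f t l /\ (l <= 0)%R) ->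
  (f b <= f a)%R.
Proof.
  intros Hab H.
  destruct (MVT_gen f a b (Derive f)) as [c [Hc E]].
  - intros x; rewrite Rmin_left, Rmax_right by exact Hab; intros Hx.
    destruct (H x ltac:(lra)) as [l [Hl _]]. apply Derive_correct; now exists l.
  - intros x; rewrite Rmin_left, Rmax_right by exact Hab; intros Hx.
    destruct (H x Hx) as [l [Hl _]].
    apply continuity_pt_filterlim, (ex_derive_continuous f); now exists l.
  - rewrite Rmin_left, Rmax_right in Hc by exact Hab.
    destruct (H c Hc) as [l [Hl Hl0]].
    rewrite (is_derive_unique _ _ _ Hl) in E; nra.
Qed.

Lemma is_derive_along_line (f : C -> C) (z h l : C) (t : R) :
  cderiv f (z + t * h) l ->
  is_derive (fun s : R => Re (f (z + s * h))) t (Re (l * h)) /\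
  is_derive (fun s : R => Im (f (z + s * h))) t (Im (l * h)).
Proof.
  intros H.
  assert (Hh := Cmod_ge_0 h).
  assert (K : forall eps : R, (0 < eps)%R -> exists d, (0 < d)%R /\ forall s : R, (Rabs (s - t) < d)%R ->
     (Cmod (f (z + s * h)%C - f (z + t * h)%C - RtoC (s - t) * (l * h)) <= eps * Rabs (s - t))%R).
  { intros eps Heps.
    (* The [+ 1] keeps the divisor positive when [h] is 0. *)
    destruct (proj1 (cderiv_eps _ _ _) H (eps / (Cmod h + 1))%R) as [d [Hd Hd']].
    { apply Rdiv_lt_0_compat; lra. }
    exists (d / (Cmod h + 1))%R; split; [apply Rdiv_lt_0_compat; lra|].
    intros s Hs; specialize (Hd' (z + s * h)).
    replace (z + s * h - (z + t * h)) with (RtoC (s - t) * h) in Hd' by (rewrite RtoC_minus; ring).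
    rewrite Cmod_mult, Cmod_R in Hd'.
    assert (Hp := Rabs_pos (s - t)).
    apply Rlt_div_r in Hs; [|lra].
    specialize (Hd' ltac:(nra)).
    rewrite <- Cmult_assoc, (Cmult_comm h) in Hd'.
    eapply Rle_trans; [exact Hd'|].
    replace (eps / (Cmod h + 1) * (Rabs (s - t) * Cmod h))%R
      with (eps * Rabs (s - t) * (Cmod h / (Cmod h + 1)))%R by (field; lra).
    rewrite <- (Rmult_1_r (eps * Rabs (s - t))) at 2.
    apply Rmult_le_compat_l; [nra|]. apply Rle_div_l; lra. }
  split; apply is_derive_eps; intros eps Heps;
    destruct (K eps Heps) as [d [Hd Hd']]; exists d; (split; [exact Hd|]);
    intros s Hs; (eapply Rle_trans; [|apply (Hd' s Hs)]).
  - eapply Rle_trans; [|apply re_le_Cmod]; right; f_equal; unfold Re; simpl; ring.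
  - eapply Rle_trans; [|apply Rabs_Im_le]; right; f_equal; unfold Im; simpl; ring.
Qed.

(* Integrating the infinitesimal Schwarz-Pick inequality along the radius to [a]. *)
Lemma schwarz (f : C -> C) (a : C) :
  (forall z, in_disk z -> exists m, cderiv f z m) -> maps_disk f -> f 0 = 0 ->
  in_disk a -> (Cmod (f a) <= Cmod a)%R.
Proof.
  intros Hf Hmap Hf0 Ha.
  destruct (Req_dec (Cmod (f a)) 0) as [E0|N0]; [rewrite E0; apply Cmod_ge_0|].
  (* The unimodular factor that rotates [f a] onto the positive real axis. *)
  set (c := Cconj (f a) / Cmod (f a)).
  assert (N0' : RtoC (Cmod (f a)) <> 0) by (intros E; apply N0; now injection E).
  assert (Hp := Cmod_ge_0 (f a)).
  assert (Hc : Cmod c = 1%R).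
  { unfold c; rewrite Cmod_div, Cmod_conj, Cmod_R, Rabs_pos_eq by assumption. field; exact N0. }
  set (r := Cmod a).
  assert (Hr : (0 <= r < 1)%R) by (split; [apply Cmod_ge_0 | exact Ha]).
  set (phi := fun s : R => Re (c * f (0 + s * a))).
  assert (Hphi1 : phi 1%R = Cmod (f a)).
  { unfold phi, c; replace (0 + 1 * a) with a by ring.
    replace (Cconj (f a) / Cmod (f a) * f a) with (f a * Cconj (f a) / Cmod (f a))
      by (field; exact N0').
    rewrite <- Cmod2_conj.
    replace (RtoC (Cmod (f a) ^ 2) / Cmod (f a)) with (RtoC (Cmod (f a))); [reflexivity|].
    simpl; rewrite Rmult_1_r, RtoC_mult; field; exact N0'. }
  assert (Hphi0 : phi 0%R = 0%R).
  { unfold phi; replace (0 + 0 * a) with (RtoC 0) by ring; rewrite Hf0; simpl; ring. }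
  assert (Hs : forall s : R, (0 <= s <= 1)%R -> Cmod (0 + s * a) = (s * r)%R /\ in_disk (0 + s * a)).
  { intros s Hs. replace (0 + s * a) with (s * a) by ring.
    unfold in_disk; rewrite Cmod_mult, Cmod_R, Rabs_pos_eq by lra; fold r; split; [reflexivity | nra]. }
  (* The quotient is tanh (artanh phi(s) - artanh (s r)), a difference of hyperbolic lengths. Its
     derivative has the sign of phi' (1 - (s r)^2) - r (1 - phi^2), which Schwarz-Pick makes
     nonpositive. *)
  assert (M : ((phi 1 - 1 * r) / (1 - 1 * r * phi 1) <= (phi 0 - 0 * r) / (1 - 0 * r * phi 0))%R).
  { apply (nonincreasing_of_derivative (fun s => (phi s - s * r) / (1 - s * r * phi s))%R); [lra|].
    intros s Hs'; destruct (Hs s Hs') as [Es Ds].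
    destruct (Hf _ Ds) as [l Hl].
    assert (SP := schwarz_pick_derivative f _ l Hf Hmap Ds Hl).
    rewrite Es in SP.
    assert (Dphi : is_derive phi s (Re (c * l * a))).
    { apply (is_derive_along_line (fun w => c * f w) 0 a (c * l) s).
      eapply cderiv_eq; [apply (cderiv_mult (fun _ => c)); [apply cderiv_const | exact Hl] | ring]. }
    assert (B1 : (Rabs (Re (c * l * a)) <= Cmod l * r)%R).
    { eapply Rle_trans; [apply re_le_Cmod|]; rewrite !Cmod_mult, Hc; fold r; lra. }
    assert (B2 : (Rabs (phi s) <= Cmod (f (0 + s * a)%C))%R).
    { eapply Rle_trans; [apply re_le_Cmod|]; rewrite Cmod_mult, Hc; lra. }
    assert (Df := Hmap _ Ds); unfold in_disk in Df.
    assert (Hsr : (0 <= s * r < 1)%R) by nra.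
    assert (Hden : (0 < 1 - s * r * phi s)%R).
    { apply Rabs_le_between in B2; nra. }
    set (D := Re (c * l * a)) in *.
    exists ((D * (1 - (s * r) ^ 2) - r * (1 - phi s ^ 2)) / (1 - s * r * phi s) ^ 2)%R; split.
    - auto_derive.
      + repeat split; try (eexists; exact Dphi). lra.
      + replace (Derive (fun x => phi x) s) with D by (symmetry; apply is_derive_unique, Dphi).
        field; lra.
    - apply Rle_div_l; [apply pow_lt, Hden|]. rewrite Rmult_0_l.
      apply Rabs_le_between in B1.
      assert (phi s ^ 2 <= Cmod (f (0 + s * a)%C) ^ 2)%R.
      { rewrite <- (pow2_abs (phi s)); apply pow_incr; split; [apply Rabs_pos | exact B2]. }
      assert (0 < 1 - (s * r) ^ 2)%R by (simpl; nra).
      assert (D * (1 - (s * r) ^ 2) <= Cmod l * r * (1 - (s * r) ^ 2))%R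
        by (apply Rmult_le_compat_r; lra).
      assert (r * (Cmod l * (1 - (s * r) ^ 2)) <= r * (1 - phi s ^ 2))%R
        by (apply Rmult_le_compat_l; lra).
      lra. }
  rewrite Hphi0, Hphi1 in M.
  replace ((0 - 0 * r) / (1 - 0 * r * 0))%R with 0%R in M by field.
  assert (Df := Hmap _ Ha); unfold in_disk in Df.
  apply Rle_div_l in M; [lra | nra].
Qed.

(** * Flows of automorphisms *)

Lemma is_derive_nonneg_eps (c : R -> C) (t : R) (l : C) :
  is_derive_nonneg c t l ->
  forall eps : R, (0 < eps)%R -> exists d : R, (0 < d)%R /\
    forall s : R, (0 <= s)%R -> (Rabs (s - t) < d)%R ->
      (Cmod (c s - c t - RtoC (s - t) * l) <= eps * Rabs (s - t))%R.
Proof.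
  intros [_ H] eps Heps.
  assert (Hlim : is_filter_lim (within (fun s : R => (0 <= s)%R) (locally t)) t).
  { intros P HP; apply filter_le_within, HP. }
  destruct (H t Hlim (mkposreal eps Heps)) as [d Hd].
  exists d; split; [apply cond_pos|].
  intros s Hs Hst; specialize (Hd s Hst Hs).
  rewrite <- Cmod_norm in Hd.
  replace (c s - c t - RtoC (s - t) * l)
    with (minus (minus (c s) (c t)) (scal (minus s t) (l : C_R_NormedModule)) : C); [exact Hd|].
  destruct (c s), (c t), l; unfold Cminus, Cplus, Copp, Cmult, RtoC; simpl.
  apply injective_projections; cbn; unfold plus, opp, scal, mult; cbn; unfold mult; cbn; ring.
Qed.

(** On the negative side of 0 the continuation is affine with slope [l 0], so its error vanishes; at
    t > 0 a radius of at most t stays among nonnegative times. *)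
Lemma is_derive_extension (x l : R -> R) :
  (forall t : R, (0 <= t)%R ->
    forall eps : R, (0 < eps)%R -> exists d : R, (0 < d)%R /\
    forall s : R, (0 <= s)%R -> (Rabs (s - t) < d)%R ->
      (Rabs (x s - x t - (s - t) * l t) <= eps * Rabs (s - t))%R) ->
  forall t : R, (0 <= t)%R ->
    is_derive (fun s => if Rle_dec 0 s then x s else (x 0 + s * l 0)%R) t (l t).
Proof.
  intros H t Ht; apply is_derive_eps; intros eps Heps.
  destruct (H t Ht eps Heps) as [d [Hd Hd']].
  destruct (Rle_dec 0 t) as [_|]; [|lra].
  destruct (Req_dec t 0) as [->|Nt].
  - exists d; split; [exact Hd|]; intros s Hs.
    destruct (Rle_dec 0 s) as [Hs0|_]; [now apply Hd'|].
    replace (x 0 + s * l 0 - x 0 - (s - 0) * l 0)%R with 0%R by ring.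
    rewrite Rabs_R0; assert (P := Rabs_pos (s - 0)); nra.
  - exists (Rmin d t); split; [apply Rmin_pos; lra|]; intros s Hs.
    assert (H1 := Rlt_le_trans _ _ _ Hs (Rmin_l _ _)).
    assert (H2 := Rlt_le_trans _ _ _ Hs (Rmin_r _ _)).
    apply Rabs_def2 in H2.
    destruct (Rle_dec 0 s) as [Hs0|]; [|lra]. now apply Hd'.
Qed.

(* Continuing the curve affinely to negative times turns the one-sided derivative
   at 0 into a two-sided one. *)
Lemma curve_extension (c l : R -> C) :
  (forall t : R, (0 <= t)%R -> is_derive_nonneg c t (l t)) ->
  exists x y : R -> R, forall t : R, (0 <= t)%R ->
    c t = (x t, y t) /\ is_derive x t (Re (l t)) /\ is_derive y t (Im (l t)).
Proof.
  intros H.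
  exists (fun s => if Rle_dec 0 s then Re (c s) else (Re (c 0%R) + s * Re (l 0%R))%R).
  exists (fun s => if Rle_dec 0 s then Im (c s) else (Im (c 0%R) + s * Im (l 0%R))%R).
  intros t Ht; split; [|split].
  - destruct (Rle_dec 0 t) as [_|]; [destruct (c t); reflexivity | lra].
  - apply (is_derive_extension (fun s => Re (c s)) (fun s => Re (l s))); [|exact Ht].
    clear t Ht; intros t Ht eps Heps.
    destruct (is_derive_nonneg_eps _ _ _ (H t Ht) eps Heps) as [d [Hd Hd']].
    exists d; split; [exact Hd|]; intros s Hs Hst.
    eapply Rle_trans; [|apply (Hd' s Hs Hst)].
    eapply Rle_trans; [|apply re_le_Cmod]; right; f_equal; unfold Re; simpl; ring.
  - apply (is_derive_extension (fun s => Im (c s)) (fun s => Im (l s))); [|exact Ht].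
    clear t Ht; intros t Ht eps Heps.
    destruct (is_derive_nonneg_eps _ _ _ (H t Ht) eps Heps) as [d [Hd Hd']].
    exists d; split; [exact Hd|]; intros s Hs Hst.
    eapply Rle_trans; [|apply (Hd' s Hs Hst)].
    eapply Rle_trans; [|apply Rabs_Im_le]; right; f_equal; unfold Im; simpl; ring.
Qed.

Lemma holomorphic_disk_cderiv (f : C -> C) :
  holomorphic_disk f -> forall z, in_disk z -> exists m, cderiv f z m.
Proof. intros H z Hz; apply ex_derive_cderiv, H, Hz. Qed.

Lemma mobius_self (c : C) : in_disk c -> mobius c c = 0.
Proof. intros Hc; unfold mobius; field; now apply one_minus_Cmod2_neq_0. Qed.

(** Both [mobius (f 0)] after [f] and its inverse, [g] after [mobius (- f 0)], fix 0, so the Schwarz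
    lemma gives the two inequalities. *)
Lemma automorphism_isometry (f : C -> C) (z : C) :
  disk_automorphism f -> in_disk z -> Cmod (mobius (f 0) (f z)) = Cmod z.
Proof.
  intros (Hf & Mf & g & Hg & Mg & Hgf & Hfg) Hz.
  assert (H0 := in_disk_0); assert (Hc := Mf 0 H0); assert (Hc' := in_disk_opp _ Hc).
  assert (Ec : mobius (- f 0) 0 = f 0).
  { generalize (mobius_opp_inv (f 0) (f 0) Hc Hc); now rewrite mobius_self. }
  apply Rle_antisym.
  - apply (schwarz (fun w => mobius (f 0) (f w))); [| | now apply mobius_self | exact Hz].
    + intros w Hw; destruct (holomorphic_disk_cderiv f Hf w Hw) as [m Hm].
      eexists; apply (cderiv_comp (mobius (f 0)) f); [apply cderiv_mobius; auto | exact Hm].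
    + intros w Hw; apply mobius_disk; auto.
  - rewrite <- (Hgf z Hz) at 1.
    rewrite <- (mobius_opp_inv (f 0) (f z) Hc (Mf z Hz)) at 1.
    apply (schwarz (fun w => g (mobius (- f 0) w))); [| | | apply mobius_disk; auto].
    + intros w Hw.
      destruct (holomorphic_disk_cderiv g Hg (mobius (- f 0) w)) as [m Hm]; [now apply mobius_disk|].
      eexists; apply (cderiv_comp g (mobius (- f 0))); [exact Hm | apply cderiv_mobius; auto].
    + intros w Hw; apply Mg, mobius_disk; auto.
    + rewrite Ec; auto.
Qed.

(** The isometry cleared of its denominator: a polynomial relation in real coordinates, ready to be
    differentiated in time. *)
Lemma automorphism_distance (f : C -> C) (z : C) :
  disk_automorphism f -> in_disk z ->
  (Cmod (f z - f 0) ^ 2 = Cmod z ^ 2 * Cmod (1 - Cconj (f 0) * f z) ^ 2)%R.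
Proof.
  intros Hf Hz; rewrite <- (automorphism_isometry f z Hf Hz).
  assert (D : 1 - Cconj (f 0) * f z <> 0).
  { destruct Hf as (_ & Mf & _); apply mobius_den; apply Mf; [apply in_disk_0 | exact Hz]. }
  unfold mobius; rewrite Cmod_div by exact D.
  apply Cmod_gt_0 in D; field; lra.
Qed.

Lemma is_derive_0_of_zero_on_nonneg (f : R -> R) (l : R) :
  is_derive f 0 l -> (forall s, (0 <= s)%R -> f s = 0%R) -> l = 0%R.
Proof.
  intros H Hf.
  destruct (Req_dec l 0) as [|N]; [assumption|exfalso].
  assert (P := Rabs_pos_lt l N).
  destruct (proj1 (is_derive_eps _ _ _) H (Rabs l / 2)%R ltac:(lra)) as [d [Hd Hd']].
  specialize (Hd' (d / 2)%R).
  rewrite (Hf 0%R), (Hf (d / 2)%R), !Rminus_0_r, Rminus_0_l, Rabs_Ropp in Hd' by lra.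
  rewrite Rabs_mult, (Rabs_pos_eq (d / 2)) in Hd' by lra.
  specialize (Hd' ltac:(lra)); nra.
Qed.

(** Differentiates at t = 0 the relation [automorphism_distance] for psi_t. Since psi_0(0) = 0, the
    derivative is twice the left side. *)
Lemma generator_identity (G : C -> C) (psi : R -> C -> C) (z : C) :
  (forall w, in_disk w -> psi 0%R w = w /\ forall t : R, (0 <= t)%R ->
     is_derive_nonneg (fun s => psi s w) t (G (psi t w))) ->
  (forall t : R, (0 <= t)%R -> disk_automorphism (psi t)) ->
  in_disk z ->
  (Re ((G z - G 0) * Cconj z) + Cmod z ^ 2 * Re (Cconj (G 0) * z) = 0)%R.
Proof.
  intros Hpsi Haut Hz.
  destruct (Hpsi z Hz) as [Iz Dz]; destruct (Hpsi 0 in_disk_0) as [I0 D0].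
  destruct (curve_extension _ _ Dz) as [x [y Hxy]].
  destruct (curve_extension _ _ D0) as [p [q Hpq]].
  destruct (Hxy 0%R (Rle_refl 0)) as (Exy & Dx & Dy).
  destruct (Hpq 0%R (Rle_refl 0)) as (Epq & Dp & Dq).
  rewrite Iz in Exy, Dx, Dy; rewrite I0 in Epq, Dp, Dq.
  (* The defect of that relation in coordinates, with psi_s(z) = x + i y and psi_s(0) = p + i q; it
     vanishes for s >= 0. *)
  set (N := fun s => (((x s - p s) ^ 2 + (y s - q s) ^ 2)
    - Cmod z ^ 2 * ((1 - (p s * x s + q s * y s)) ^ 2 + (p s * y s - q s * x s) ^ 2))%R).
  assert (HN : forall s, (0 <= s)%R -> N s = 0%R).
  { intros s Hs.
    assert (E := automorphism_distance (psi s) z (Haut s Hs) Hz).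
    rewrite (proj1 (Hxy s Hs)), (proj1 (Hpq s Hs)), (Cmod2_alt (_ - _)), (Cmod2_alt (1 - _)) in E.
    unfold N, Re, Im in *; simpl in *. nra. }
  injection Epq as Ep Eq.
  assert (Ez : z = (x 0, y 0)%R) by exact Exy.
  apply (Rmult_eq_reg_l 2); [rewrite Rmult_0_r | lra].
  apply is_derive_0_of_zero_on_nonneg with N; [|exact HN].
  unfold N; auto_derive.
  - repeat split; eexists; eassumption.
  - replace (Derive (fun x0 => x x0) 0) with (Re (G z)) by (symmetry; apply is_derive_unique, Dx).
    replace (Derive (fun x0 => y x0) 0) with (Im (G z)) by (symmetry; apply is_derive_unique, Dy).
    replace (Derive (fun x0 => p x0) 0) with (Re (G 0)) by (symmetry; apply is_derive_unique, Dp).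
    replace (Derive (fun x0 => q x0) 0) with (Im (G 0)) by (symmetry; apply is_derive_unique, Dq).
    rewrite <- Ep, <- Eq.
    replace (x 0%R) with (Re z) by (rewrite Ez at 1; reflexivity).
    replace (y 0%R) with (Im z) by (rewrite Ez at 1; reflexivity).
    unfold Re, Im; simpl; ring.
Qed.

(** * The quadratic form of the generator and the consequence of Re p >= 0 *)

(** Differentiating Re f in direction h gives Re (l h) = 0; the directions 1 and i remove both parts
    of [l]. *)
Lemma cderiv_eq_0_of_Re_eq_0 (f : C -> C) (z l : C) (d : R) :
  (0 < d)%R -> (forall w, (Cmod (w - z) < d)%R -> Re (f w) = 0%R) ->
  cderiv f z l -> l = 0.
Proof.
  intros Hd H Hl.
  assert (K : forall h : C, Cmod h = 1%R -> Re (l * h) = 0%R).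
  { intros h Hh.
    assert (D : is_derive (fun s : R => Re (f (z + s * h))) 0 (Re (l * h))).
    { apply (is_derive_along_line f z h l 0).
      replace (z + 0 * h) with z by ring; exact Hl. }
    apply (is_derive_unique (fun s : R => Re (f (z + s * h))) 0) in D; rewrite <- D.
    apply is_derive_unique, (is_derive_ext_loc (V := R_NormedModule) (fun _ => 0%R)).
    - exists (mkposreal d Hd); intros s Hs; symmetry; apply H.
      replace (z + s * h - z) with (s * h) by ring.
      rewrite Cmod_mult, Hh, Cmod_R, Rmult_1_r.
      replace s with (s - 0)%R by ring; exact Hs.
    - apply (is_derive_const (V := R_NormedModule)). }
  assert (K1 := K 1 Cmod_1); assert (K2 := K Ci Cmod_Ci).
  destruct l as [a b]; unfold Re in *; simpl in *.
  apply injective_projections; simpl; lra.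
Qed.

(* [(G z - a) / z + conj a * z] has vanishing real part, hence zero derivative, so it is
   constant on every punctured radius, with limit the derivative at 0. *)
Lemma generator_form (G : C -> C) :
  (forall z, in_disk z -> exists l, cderiv G z l) ->
  (forall z, in_disk z ->
    (Re ((G z - G 0) * Cconj z) + Cmod z ^ 2 * Re (Cconj (G 0) * z) = 0)%R) ->
  exists m : R, forall z, in_disk z ->
    G z = G 0 - Cconj (G 0) * z * z + Ci * m * z.
Proof.
  intros HG HI; set (a := G 0) in *.
  set (q := fun z => G z - a + Cconj a * (z * z)).
  set (H := fun z => q z / z).
  assert (Hq : forall z, in_disk z -> exists l, cderiv q z l).
  { intros z Hz; destruct (HG z Hz) as [l Hl]; eexists.
    apply (cderiv_plus (fun z => G z - a) (fun z => Cconj a * (z * z))).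
    - apply (cderiv_minus G (fun _ => a)); [exact Hl | apply cderiv_const].
    - apply (cderiv_mult (fun _ => Cconj a) (fun z => z * z)); [apply cderiv_const|].
      apply (cderiv_mult (fun z => z) (fun z => z)); apply cderiv_id. }
  assert (HRe : forall z, in_disk z -> z <> 0 -> Re (H z) = 0%R).
  { intros z Hz Nz.
    assert (P := proj1 (Cmod_gt_0 z) Nz).
    (* The hypothesis says that the left side has real part 0. *)
    assert (E : q z * Cconj z = RtoC (Cmod z ^ 2) * H z).
    { unfold H; rewrite Cmod2_conj; field; exact Nz. }
    apply (f_equal Re) in E.
    replace (Re (RtoC (Cmod z ^ 2) * H z)) with (Cmod z ^ 2 * Re (H z))%R in E
      by (unfold Re; simpl; ring).
    assert (E' : Re (q z * Cconj z) = 0%R).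
    { rewrite <- (HI z Hz), Cmod2_alt; unfold q, Re, Im; simpl; ring. }
    rewrite E' in E; symmetry in E; apply Rmult_integral in E.
    destruct E as [E|E]; [|exact E]. assert (Q := pow_lt _ 2 P); lra. }
  assert (HD : forall z, in_disk z -> z <> 0 -> cderiv H z 0).
  { intros z Hz Nz; destruct (Hq z Hz) as [l Hl].
    assert (Hl' := cderiv_div q (fun z => z) z l 1 Nz Hl (cderiv_id z)).
    change (fun w => q w / w) with H in Hl'.
    assert (P := proj1 (Cmod_gt_0 z) Nz); unfold in_disk in Hz.
    eapply cderiv_eq; [exact Hl'|].
    apply (cderiv_eq_0_of_Re_eq_0 H z _ (Rmin (Cmod z) (1 - Cmod z)));
      [apply Rmin_pos; lra | | exact Hl'].
    intros w Hw.
    assert (H1 := Rlt_le_trans _ _ _ Hw (Rmin_l _ _)).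
    assert (H2 := Rlt_le_trans _ _ _ Hw (Rmin_r _ _)).
    apply HRe.
    - unfold in_disk; assert (T := Cmod_triangle_minus w z); lra.
    - intros ->; rewrite Cmod_minus_sym in H1.
      replace (z - 0) with z in H1 by ring; lra. }
  destruct (Hq 0 in_disk_0) as [lam Hlam].
  assert (Hq0 : q 0 = 0) by (unfold q, a; ring).
  assert (Hconst : forall z, in_disk z -> z <> 0 -> H z = lam).
  { intros z Hz Nz.
    assert (P := proj1 (Cmod_gt_0 z) Nz).
    assert (Ray : forall s : R, (0 < s < 1)%R -> H (s * z) = H z).
    { intros s Hs.
      assert (Dr : forall t : R, (s <= t <= 1)%R ->
        is_derive (fun t : R => Re (H (0 + t * z))) t 0%R /\
        is_derive (fun t : R => Im (H (0 + t * z))) t 0%R).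
      { intros t Ht.
        assert (D := is_derive_along_line H 0 z 0 t).
        replace (Re (0 * z)) with 0%R in D by (unfold Re; simpl; ring).
        replace (Im (0 * z)) with 0%R in D by (unfold Im; simpl; ring).
        apply D; replace (0 + t * z) with (t * z) by ring; apply HD.
        - unfold in_disk in *; rewrite Cmod_mult, Cmod_R, Rabs_pos_eq by lra; nra.
        - apply Cmult_neq_0; [|exact Nz]; intros E; injection E; lra. }
      assert (E1 := eq_is_derive (V := R_NormedModule) _ s 1%R (fun t Ht => proj1 (Dr t Ht)) (proj2 Hs)).
      assert (E2 := eq_is_derive (V := R_NormedModule) _ s 1%R (fun t Ht => proj2 (Dr t Ht)) (proj2 Hs)).
      cbv beta in E1, E2.
      replace (0 + s * z) with (s * z) in * by ring.
      replace (0 + 1 * z) with z in * by ring.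
      apply injective_projections; [exact E1 | exact E2]. }
    destruct (Ceq_dec (H z) lam) as [E|N]; [exact E | exfalso].
    assert (N' : H z - lam <> 0).
    { intros E; apply N; replace (H z) with (H z - lam + lam) by ring; rewrite E; ring. }
    apply Cmod_gt_0 in N'.
    (* [H] is constant along the ray, so the linearisation error of [q] at s z is exactly (H z -
       lam) s z, twice what this tolerance allows for small s. *)
    destruct (proj1 (cderiv_eps _ _ _) Hlam (Cmod (H z - lam) / 2)%R ltac:(lra)) as [d [Hd Hd']].
    set (s := Rmin (1 / 2) (d / 2)).
    assert (Hs : (0 < s < 1)%R).
    { split; [apply Rmin_pos; lra|].
      apply Rle_lt_trans with (1 / 2)%R; [apply Rmin_l | lra]. }
    assert (Hsd : (s <= d / 2)%R) by apply Rmin_r.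
    specialize (Hd' (s * z)).
    assert (Ns : s * z <> 0).
    { apply Cmult_neq_0; [|exact Nz]; intros E; injection E; lra. }
    replace (s * z - 0) with (s * z) in Hd' by ring.
    replace (q (s * z) - q 0 - s * z * lam) with ((H z - lam) * (s * z)) in Hd'.
    2:{ rewrite <- (Ray s Hs), Hq0; unfold H; field.
        split; [exact Nz|]; intros E; apply RtoC_inj in E; lra. }
    rewrite !Cmod_mult, Cmod_R, Rabs_pos_eq in Hd' by lra.
    unfold in_disk in Hz.
    specialize (Hd' ltac:(nra)).
    assert (0 < s * Cmod z)%R by (apply Rmult_lt_0_compat; lra).
    nra. }
  (* Any nonzero point of the disk, here 1/2, transfers Re H = 0 to [lam]. *)
  assert (Hlam0 : Re lam = 0%R).
  { assert (Hh : in_disk (RtoC (/ 2))).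
    { unfold in_disk; rewrite Cmod_R, Rabs_pos_eq by lra; lra. }
    assert (Nh : RtoC (/ 2) <> 0) by (intros E; apply RtoC_inj in E; lra).
    rewrite <- (Hconst _ Hh Nh); now apply HRe. }
  exists (Im lam); intros z Hz.
  destruct (Ceq_dec z 0) as [->|Nz]; [unfold a; ring|].
  assert (E : Ci * Im lam = lam).
  { destruct lam as [x y]; unfold Re, Im in *; simpl in *; subst x.
    apply injective_projections; simpl; ring. }
  rewrite E, <- (Hconst z Hz Nz); unfold H, q; field; exact Nz.
Qed.

Lemma nonneg_form (p : C -> C) (k m : R) :
  (forall z, in_disk z -> (0 <= Re (p z))%R) ->
  (forall z, in_disk z -> (z - 1) ^ 2 * p z - Ci * k * z
     = p 0 - Cconj (p 0) * z * z + Ci * m * z) ->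
  exists A B : R, (0 <= A)%R /\
    forall z : C, in_disk z -> p z = A * ((1 + z) / (1 - z)) + B * Ci.
Proof.
  intros Hp HE.
  (* The equation reads (z - 1)^2 p = A (1 - z^2) + i B (1 + z^2) + i (m + k) z, and 1 + z^2 = (1 -
     z)^2 + 2 z moves 2 B into the last coefficient. *)
  set (A := Re (p 0)); set (B := Im (p 0)); set (n := (2 * B + m + k)%R).
  assert (HA := Hp 0 in_disk_0); fold A in HA.
  assert (N1 : forall z, in_disk z -> 1 - z <> 0).
  { intros z Hz E; assert (z = 1) by (replace z with (1 - (1 - z)) by ring; rewrite E; ring).
    subst z; unfold in_disk in Hz; rewrite Cmod_1 in Hz; lra. }
  assert (F : forall z, in_disk z ->
    p z = A * ((1 + z) / (1 - z)) + B * Ci + Ci * n * z / ((1 - z) * (1 - z))).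
  { intros z Hz; specialize (HE z Hz); assert (N := N1 z Hz).
    assert (E0 : p 0 = A + B * Ci).
    { unfold A, B; destruct (p 0); apply injective_projections; simpl; unfold Re, Im; simpl; ring. }
    assert (E1 : Cconj (p 0) = A - B * Ci).
    { unfold A, B; destruct (p 0); apply injective_projections; simpl; unfold Re, Im; simpl; ring. }
    rewrite E1, E0 in HE.
    replace (p z) with (((z - 1) ^ 2 * p z - Ci * k * z + Ci * k * z) / ((1 - z) * (1 - z)))
      by (field; exact N).
    rewrite HE; unfold n; rewrite !RtoC_plus, RtoC_mult; field; exact N. }
  exists A, B; split; [exact HA|]; intros z Hz.
  rewrite (F z Hz).
  destruct (Req_dec n 0) as [->|Nn]; [unfold Cdiv; ring | exfalso].
  (* At 1/(1 - z) = 1 + i y the real part of p is A - n y; this y makes it -1. *)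
  clear z Hz; set (y := ((A + 1) / n)%R).
  set (w := (1, y) : C).
  assert (Nw : w <> 0) by (intros E; injection E; lra).
  set (z := 1 - / w).
  assert (Hz : in_disk z).
  { unfold in_disk, z; replace (1 - / w) with ((w - 1) / w) by (field; exact Nw).
    rewrite Cmod_div by exact Nw.
    apply Rlt_div_l; [now apply Cmod_gt_0|]; rewrite Rmult_1_l.
    unfold Cmod; apply sqrt_lt_1_alt; simpl; split; nra. }
  assert (P := Hp z Hz); rewrite (F z Hz) in P.
  assert (Ez : A * ((1 + z) / (1 - z)) + B * Ci + Ci * n * z / ((1 - z) * (1 - z))
     = A * (2 * w - 1) + B * Ci + Ci * n * (w * w - w)).
  { unfold z; field; split; [exact Nw|].
    replace (1 - (1 - / w)) with (/ w) by ring.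
    replace (w - (w - 1)) with (RtoC 1) by ring. apply C1_nz. }
  rewrite Ez in P; unfold Re in P; simpl in P.
  assert (n * y = A + 1)%R by (unfold y; field; exact Nn).
  nra.
Qed.

(** * The Riccati flow *)

(** The inverse divides by [u] and applies [mobius (- c)]. The formula for [f] is given only on the
    disk, so differentiability is transferred on the ball of radius [1 - Cmod z]. *)
Lemma rotation_mobius_automorphism (f : C -> C) (u c : C) :
  Cmod u = 1%R -> in_disk c -> (forall z, in_disk z -> f z = u * mobius c z) ->
  disk_automorphism f.
Proof.
  intros Hu Hc Hf.
  assert (Nu : u <> 0) by (apply Cmod_gt_0; lra).
  assert (Hc' := in_disk_opp c Hc).
  assert (Hrot : forall v w, Cmod v = 1%R -> in_disk w -> in_disk (v * w)).
  { intros v w Hv; unfold in_disk; rewrite Cmod_mult, Hv, Rmult_1_l; auto. }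
  assert (Hu' : Cmod (/ u) = 1%R) by (rewrite Cmod_inv, Hu by exact Nu; lra).
  split; [|split].
  - intros z Hz; apply ex_derive_cderiv; eexists.
    apply (cderiv_ext_near (fun z => u * mobius c z) f z _ (1 - Cmod z)).
    + unfold in_disk in Hz; lra.
    + intros w Hw; symmetry; apply Hf; unfold in_disk.
      assert (T := Cmod_triangle_minus w z); lra.
    + apply (cderiv_mult (fun _ => u) (mobius c)); [apply cderiv_const | now apply cderiv_mobius].
  - intros z Hz; rewrite Hf by exact Hz; apply Hrot; [exact Hu | now apply mobius_disk].
  - exists (fun w => mobius (- c) (/ u * w)); split; [|split; [|split]].
    + intros z Hz; apply ex_derive_cderiv; eexists.
      apply (cderiv_comp (mobius (- c)) (fun w => / u * w)).
      * apply cderiv_mobius; [exact Hc' | now apply Hrot].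
      * apply (cderiv_mult (fun _ => / u) (fun w => w)); [apply cderiv_const | apply cderiv_id].
    + intros z Hz; apply mobius_disk; [exact Hc' | now apply Hrot].
    + intros z Hz; rewrite Hf by exact Hz.
      replace (/ u * (u * mobius c z)) with (mobius c z) by (field; exact Nu).
      now apply mobius_opp_inv.
    + intros z Hz; rewrite Hf by (apply mobius_disk; [exact Hc' | now apply Hrot]).
      replace c with (- - c) at 1 by ring.
      rewrite mobius_opp_inv; [field; exact Nu | exact Hc' | now apply Hrot].
Qed.

(** These are cosh (r t) and sinh (r t)/r with r^2 = delta, trigonometric for delta < 0 and 1, t for
    delta = 0. If a matrix X satisfies X^2 = delta I, then exp (t X) = ch(t) I + sh(t) X. *)
Lemma hyperbolic_functions (delta : R) : exists ch sh : R -> R,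
  ch 0%R = 1%R /\ sh 0%R = 0%R /\
  (forall t, is_derive ch t (delta * sh t)%R) /\ (forall t, is_derive sh t (ch t)) /\
  (forall t, (ch t ^ 2 - delta * sh t ^ 2 = 1)%R).
Proof.
  destruct (Rtotal_order delta 0) as [H|[->|H]].
  - set (r := sqrt (- delta)).
    assert (Hr : (0 < r)%R) by (apply sqrt_lt_R0; lra).
    assert (Er : delta = (- (r * r))%R) by (unfold r; rewrite sqrt_sqrt; lra).
    exists (fun t => cos (r * t)), (fun t => (sin (r * t) / r)%R).
    rewrite Er; split; [|split; [|split; [|split]]].
    + rewrite Rmult_0_r; apply cos_0.
    + rewrite Rmult_0_r, sin_0; field; lra.
    + intros t; auto_derive; [trivial | field; lra].
    + intros t; auto_derive; [lra | field; lra].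
    + intros t; rewrite <- (sin2_cos2 (r * t)); unfold Rsqr; field; lra.
  - exists (fun _ => 1%R), (fun t => t); split; [lra | split; [lra | split; [|split]]].
    + intros t; auto_derive; [trivial | lra].
    + intros t; apply (is_derive_id (K := R_AbsRing)).
    + intros t; lra.
  - set (r := sqrt delta).
    assert (Hr : (0 < r)%R) by (apply sqrt_lt_R0; lra).
    assert (Er : delta = (r * r)%R) by (unfold r; rewrite sqrt_sqrt; lra).
    exists (fun t => ((exp (r * t) + exp (- (r * t))) / 2)%R),
           (fun t => ((exp (r * t) - exp (- (r * t))) / (2 * r))%R).
    rewrite Er; split; [|split; [|split; [|split]]].
    + rewrite Rmult_0_r, Ropp_0, exp_0; lra.
    + rewrite Rmult_0_r, Ropp_0, exp_0; field; lra.
    + intros t; auto_derive; [trivial | field; lra].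
    + intros t; auto_derive; [lra | field; lra].
    + intros t.
      assert (E : (exp (r * t) * exp (- (r * t)) = 1)%R)
        by (rewrite <- exp_plus, Rplus_opp_r; apply exp_0).
      transitivity (exp (r * t) * exp (- (r * t)))%R; [field; lra | exact E].
Qed.

(** The function e(t) exp (-K t) has derivative (g - K) e exp (-K t) <= 0, so it never rises above
    its initial value 0. *)
Lemma gronwall_zero (e g : R -> R) (K : R) :
  (forall t, (0 <= t)%R -> is_derive e t (g t * e t)%R) ->
  (forall t, (0 <= t)%R -> (g t <= K)%R) -> (forall t, (0 <= e t)%R) ->
  e 0%R = 0%R -> forall t, (0 <= t)%R -> e t = 0%R.
Proof.
  intros De Hg He E0 t Ht.
  assert (M : (e t * exp (- K * t) <= e 0 * exp (- K * 0))%R).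
  { apply (nonincreasing_of_derivative (fun s => e s * exp (- K * s))%R); [exact Ht|].
    intros s Hs; exists ((g s - K) * (e s * exp (- K * s)))%R; split.
    - auto_derive; [eexists; apply De; lra|].
      replace (Derive (fun x => e x) s) with (g s * e s)%R
        by (symmetry; apply is_derive_unique, De; lra).
      ring.
    - assert (P := exp_pos (- K * s)).
      assert (0 <= e s * exp (- K * s))%R by (apply Rmult_le_pos; [apply He | lra]).
      specialize (Hg s ltac:(lra)); nra. }
  rewrite E0, Rmult_0_l in M.
  assert (P := exp_pos (- K * t)); assert (Q := He t).
  destruct Q as [Q|Q]; [|lra]. exfalso.
  assert (0 < e t * exp (- K * t))%R by (apply Rmult_lt_0_compat; lra). lra.
Qed.

(* [(w, 1)] transported by [exp (- t X)], [X = ((i c / 2, a), (conj a, - i c / 2))], stays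
   parallel to [(z, 1)]; the defect [E] below solves a homogeneous linear equation. *)
Lemma riccati_flow (A B c : R) (w : R -> C) (z : C) :
  w 0%R = z ->
  (forall t, (0 <= t)%R -> in_disk (w t) /\ is_derive_nonneg w t
     ((A + B * Ci) - Cconj (A + B * Ci) * w t * w t + Ci * c * w t)) ->
  forall ch sh : R -> R, ch 0%R = 1%R -> sh 0%R = 0%R ->
  (forall t, is_derive ch t ((A ^ 2 + B ^ 2 - c ^ 2 / 4) * sh t)%R) ->
  (forall t, is_derive sh t (ch t)) ->
  forall t, (0 <= t)%R ->
    Cconj (ch t, sh t * c / 2)%R * w t - (sh t * A, sh t * B)%R
      = z * ((ch t, sh t * c / 2)%R - Cconj (sh t * A, sh t * B)%R * w t).
Proof.
  intros W0 HW ch sh Ech Esh Dch Dsh.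
  destruct (curve_extension w _ (fun t Ht => proj2 (HW t Ht))) as [x [y Hxy]].
  assert (Hx : forall t, (0 <= t)%R ->
     is_derive x t (A - c * y t - (A * (x t ^ 2 - y t ^ 2) + 2 * B * x t * y t))%R).
  { intros t Ht; destruct (Hxy t Ht) as (E & D & _); rewrite E in D.
    replace (A - c * y t - (A * (x t ^ 2 - y t ^ 2) + 2 * B * x t * y t))%R
      with (Re (A + B * Ci - Cconj (A + B * Ci) * (x t, y t) * (x t, y t) + Ci * c * (x t, y t)));
      [exact D | unfold Re; simpl; ring]. }
  assert (Hy : forall t, (0 <= t)%R ->
     is_derive y t (B + c * x t - 2 * A * x t * y t + B * (x t ^ 2 - y t ^ 2))%R).
  { intros t Ht; destruct (Hxy t Ht) as (E & _ & D); rewrite E in D.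
    replace (B + c * x t - 2 * A * x t * y t + B * (x t ^ 2 - y t ^ 2))%R
      with (Im (A + B * Ci - Cconj (A + B * Ci) * (x t, y t) * (x t, y t) + Ci * c * (x t, y t)));
      [exact D | unfold Im; simpl; ring]. }
  destruct z as [z1 z2].
  assert (Exy := proj1 (Hxy 0%R (Rle_refl 0))); rewrite W0 in Exy; injection Exy as Ex Ey.
  (* [E1] and [E2] are the real and imaginary parts of the left side minus the right side of the
     goal. *)
  set (E1 := fun t => (ch t * x t + sh t * c / 2 * y t - sh t * A
     + z1 * (sh t * (A * x t + B * y t)) - z2 * (sh t * (A * y t - B * x t))
     - (z1 * ch t - z2 * (sh t * c / 2)))%R).
  set (E2 := fun t => (ch t * y t - sh t * c / 2 * x t - sh t * B
     + z1 * (sh t * (A * y t - B * x t)) + z2 * (sh t * (A * x t + B * y t))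
     - (z1 * (sh t * c / 2) + z2 * ch t))%R).
  assert (Hex : forall t, (0 <= t)%R -> ex_derive ch t /\ ex_derive sh t /\ ex_derive x t /\ ex_derive y t).
  { intros t Ht; repeat split; eexists; [apply Dch | apply Dsh | apply Hx, Ht | apply Hy, Ht]. }
  (* The growth rate of |E|^2 is -2 Re (conj a w) = -2 (A x + B y), bounded because w stays in the
     disk. *)
  assert (Hder : forall t, (0 <= t)%R ->
     is_derive (fun t => E1 t ^ 2 + E2 t ^ 2)%R t
       ((- 2 * (A * x t + B * y t)) * (E1 t ^ 2 + E2 t ^ 2))%R).
  { intros t Ht; destruct (Hex t Ht) as (X1 & X2 & X3 & X4).
    unfold E1, E2; auto_derive; [tauto|].
    replace (Derive (fun t => x t) t) with (A - c * y t - (A * (x t ^ 2 - y t ^ 2) + 2 * B * x t * y t))%R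
      by (symmetry; apply is_derive_unique, Hx, Ht).
    replace (Derive (fun t => y t) t) with (B + c * x t - 2 * A * x t * y t + B * (x t ^ 2 - y t ^ 2))%R
      by (symmetry; apply is_derive_unique, Hy, Ht).
    replace (Derive (fun t => ch t) t) with ((A ^ 2 + B ^ 2 - c ^ 2 / 4) * sh t)%R
      by (symmetry; apply is_derive_unique, Dch).
    replace (Derive (fun t => sh t) t) with (ch t)
      by (symmetry; apply is_derive_unique, Dsh).
    field. }
  intros t Ht.
  assert (Z : (E1 t ^ 2 + E2 t ^ 2 = 0)%R).
  { apply (gronwall_zero (fun t => E1 t ^ 2 + E2 t ^ 2)%R
      (fun t => - 2 * (A * x t + B * y t))%R (2 * (Rabs A + Rabs B)) Hder).
    - intros s Hs; destruct (HW s Hs) as [D _]; unfold in_disk in D.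
      rewrite (proj1 (Hxy s Hs)) in D.
      assert (B1 := re_le_Cmod (x s, y s)); assert (B2 := Rabs_Im_le (x s, y s)); simpl in B1, B2.
      assert (P1 : (Rabs (A * x s) <= Rabs A)%R).
      { rewrite Rabs_mult; assert (Q := Rabs_pos A); nra. }
      assert (P2 : (Rabs (B * y s) <= Rabs B)%R).
      { rewrite Rabs_mult; assert (Q := Rabs_pos B); nra. }
      apply Rabs_le_between in P1; apply Rabs_le_between in P2; lra.
    - intros s; assert (Q1 := pow2_ge_0 (E1 s)); assert (Q2 := pow2_ge_0 (E2 s)); lra.
    - unfold E1, E2; rewrite Ech, Esh, <- Ex, <- Ey; field.
    - exact Ht. }
  assert (Z1 : E1 t = 0%R) by nra.
  assert (Z2 : E2 t = 0%R) by nra.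
  rewrite (proj1 (Hxy t Ht)).
  unfold E1 in Z1; unfold E2 in Z2.
  apply injective_projections; simpl; lra.
Qed.

(** Solving the relation of [riccati_flow] for psi_t(z) gives (al z + be) / (conj al + conj be z), a
    rotation by al / conj al after [mobius (- be / al)]. *)
Lemma riccati_automorphism (A B c : R) (psi : R -> C -> C) :
  (forall z, in_disk z -> psi 0%R z = z /\ forall t, (0 <= t)%R ->
     in_disk (psi t z) /\ is_derive_nonneg (fun s => psi s z) t
       ((A + B * Ci) - Cconj (A + B * Ci) * psi t z * psi t z + Ci * c * psi t z)) ->
  forall t, (0 <= t)%R -> disk_automorphism (psi t).
Proof.
  intros Hpsi t Ht.
  destruct (hyperbolic_functions (A ^ 2 + B ^ 2 - c ^ 2 / 4)) as (ch & sh & Ech & Esh & Dch & Dsh & I).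
  specialize (I t).
  set (al := (ch t, sh t * c / 2)%R : C); set (be := (sh t * A, sh t * B)%R : C).
  (* This is det exp (t X) = 1, obtained from ch^2 - delta sh^2 = 1; it places be / al inside the
     disk. *)
  assert (N : (Cmod al ^ 2 = Cmod be ^ 2 + 1)%R).
  { rewrite !Cmod2_alt; unfold al, be, Re, Im; simpl; simpl in I; lra. }
  assert (Hal := Cmod_ge_0 al); assert (Hbe := Cmod_ge_0 be).
  assert (Pal : (0 < Cmod al)%R) by (simpl in N; nra).
  assert (Nal : al <> 0) by (now apply Cmod_gt_0).
  assert (Nal' : Cconj al <> 0) by (apply Cmod_gt_0; now rewrite Cmod_conj).
  assert (Hc : in_disk (- be / al)).
  { unfold in_disk; rewrite Cmod_div, Cmod_opp by exact Nal.
    apply Rlt_div_l; [exact Pal|]; simpl in N; nra. }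
  apply rotation_mobius_automorphism with (al / Cconj al) (- be / al).
  - rewrite Cmod_div, Cmod_conj by exact Nal'; field; lra.
  - exact Hc.
  - intros z Hz; destruct (Hpsi z Hz) as [W0 HW].
    assert (E := riccati_flow A B c (fun s => psi s z) z W0 HW ch sh Ech Esh Dch Dsh t Ht).
    fold al be in E.
    assert (D := mobius_den _ _ Hc Hz).
    assert (Ec : Cconj (- be / al) = - Cconj be / Cconj al).
    { rewrite Cdiv_conj, Copp_conj by exact Nal; reflexivity. }
    unfold mobius; rewrite Ec in *.
    assert (D' : Cconj al + Cconj be * z <> 0).
    { intros E'; apply D.
      replace (1 - - Cconj be / Cconj al * z) with ((Cconj al + Cconj be * z) / Cconj al)
        by (field; exact Nal').
      rewrite E'; unfold Cdiv; ring. }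
    replace (psi t z) with (psi t z * (Cconj al + Cconj be * z) / (Cconj al + Cconj be * z))
      by (field; exact D').
    replace (psi t z * (Cconj al + Cconj be * z)) with (al * z + be).
    + field; repeat split; auto.
      replace (Cconj al - - Cconj be * z) with (Cconj al + Cconj be * z) by ring; exact D'.
    + transitivity (Cconj al * psi t z - be + be + z * Cconj be * psi t z); [|ring].
      rewrite E; ring.
Qed.

(** * Semigroups of automorphisms characterised through their generators *)

Theorem proposition2 :
  forall (p : C -> C) (k : R) (psi : R -> C -> C),
    holomorphic_disk p ->
    (forall z : C, in_disk z -> (0 <= Re (p z))%R) ->
    solves_ivp p k psi ->
    ((forall t : R, (0 <= t)%R -> disk_automorphism (psi t))
     <->
     (exists A B : R, (0 <= A)%R /\
        forall z : C, in_disk z -> p z = A * ((1 + z) / (1 - z)) + B * Ci)).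
Proof.
  intros p k psi Hp Hre Hivp; split.
  - intros Haut.
    set (G := fun z => (z - 1) ^ 2 * p z - Ci * k * z).
    assert (HG0 : G 0 = p 0) by (unfold G; ring).
    assert (HG : forall z, in_disk z -> exists l, cderiv G z l).
    { intros z Hz; destruct (holomorphic_disk_cderiv p Hp z Hz) as [l Hl]; eexists.
      apply (cderiv_minus (fun z => (z - 1) ^ 2 * p z) (fun z => Ci * k * z)).
      - apply (cderiv_mult (fun z => (z - 1) ^ 2) p); [|exact Hl].
        assert (D1 : cderiv (fun z => z - 1) z (1 - 0))
          by (apply (cderiv_minus (fun z => z) (fun _ => RtoC 1)); [apply cderiv_id | apply cderiv_const]).
        apply (cderiv_mult (fun z => z - 1) (fun z => (z - 1) * 1)); [exact D1|].
        apply (cderiv_mult (fun z => z - 1) (fun _ => RtoC 1)); [exact D1 | apply cderiv_const].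
      - apply (cderiv_mult (fun _ => Ci * k) (fun z => z)); [apply cderiv_const | apply cderiv_id]. }
    destruct (generator_form G HG) as [m Hm].
    { intros z Hz; apply (generator_identity G psi z); [|exact Haut | exact Hz].
      intros w Hw; destruct (Hivp w Hw) as [I0 D]; split; [exact I0|].
      intros t Ht; apply D, Ht. }
    rewrite HG0 in Hm.
    exact (nonneg_form p k m Hre Hm).
  - intros (A & B & _ & Hform).
    (* Expanding B i (w - 1)^2 yields the linear term -2 B i w, and the rotation adds -i k w. *)
    apply (riccati_automorphism A B (- 2 * B - k)).
    intros z Hz; destruct (Hivp z Hz) as [I0 D]; split; [exact I0|].
    intros t Ht; destruct (D t Ht) as [D1 D2]; split; [exact D1|].
    rewrite Hform in D2 by exact D1.
    set (w := psi t z) in *.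
    assert (N : 1 - w <> 0).
    { intros E; assert (E' : w = 1) by (replace w with (1 - (1 - w)) by ring; rewrite E; ring).
      unfold in_disk in D1; rewrite E', Cmod_1 in D1; lra. }
    replace (A + B * Ci - Cconj (A + B * Ci) * w * w + Ci * (- 2 * B - k)%R * w)
      with ((w - 1) ^ 2 * (A * ((1 + w) / (1 - w)) + B * Ci) - Ci * k * w); [exact D2|].
    assert (Ec : Cconj (A + B * Ci) = A - B * Ci)
      by (apply injective_projections; simpl; ring).
    rewrite Ec, RtoC_minus, RtoC_mult; field; exact N.
Qed.
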